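(* Let $F=\mathbb{Q}$ and let $A = \mathbb{Q}\{x,y\}/(x^2=y^2=-1,\ xy=-yx)$ be the quaternion algebra. Let $a$ and $b$ be independent variables over $\mathbb{Q}$, let $E$ be the field of fractions of $\mathbb{Q}[a,b]/(a^2+b^2+1)$, and let $M$ be the $2$-dimensional $A_E$-module given by $$x \mapsto \begin{pmatrix} a & b \\ b & -a \end{pmatrix},\qquad y \mapsto \begin{pmatrix} b & -a \\ -a & -b \end{pmatrix}.$$ Then (a) $\mathrm{ed}(M) = 1$; (b) $M$ does not have a minimal field of definition.
   Context: $\mathbb{Q}\{x,y\}$ is the free associative algebra on $x,y$. For a field extension $E/\mathbb{Q}$, $A_E := E\otimes_{\mathbb{Q}} A$. An intermediate field $\mathbb{Q} \subset E_0 \subset E$ is a field of definition for an $A_E$-module $M$ (equivalently, $M$ descends to $E_0$) if there exists a finitely generated $A_{E_0}$-module $M_0$ with $M \cong E \otimes_{E_0} M_0$ as $A_E$-modules. A field of definition $E_0$ of $M$ is minimal if whenever $M$ descends to an intermediate field $\mathbb{Q} \subset L \subset E$, we have $E_0 \subset L$. The essential dimension $\mathrm{ed}(M)$ of $M$ over $\mathbb{Q}$ is the minimal value of $\mathrm{trdeg}(E_0/\mathbb{Q})$, where $E_0$ ranges over all fields of definition $\mathbb{Q} \subset E_0 \subset E$ of $M$. *)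

(* Defs.v *)
From HB Require Import structures.
From mathcomp Require Import mpoly.
From mathcomp Require Import all_boot all_order all_algebra.
From mathcomp Require Import generic_quotient boolp.
From mathcomp Require Import finmap monalg.
From mathcomp Require Import ring.

Set Implicit Arguments.
Unset Strict Implicit.
Unset Printing Implicit Defensive.

Import Order.TTheory GRing.Theory Num.Theory.
Local Open Scope ring_scope.
Local Open Scope quotient_scope.

Section FinGen.
Variables (R : pzRingType).

Definition finitely_generated (V : lmodType R) : Prop :=
  exists s : seq V, forall v : V,
    exists c : 'I_(size s) -> R, v = \sum_(i < size s) c i *: s`_i.

Definition lmod_isomorphic (V W : lmodType R) : Prop :=
  exists f : {linear V -> W}, bijective f.

End FinGen.

Definition restrict_scalars (R S : pzRingType) (phi : {rmorphism R -> S})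
  (V : lmodType S) : Type := V.

Section RestrictScalars.
Variables (R S : pzRingType) (phi : {rmorphism R -> S}) (V : lmodType S).
Local Notation restrict_scalars := (restrict_scalars phi V).

HB.instance Definition _ := GRing.Zmodule.on restrict_scalars.

Definition restrict_scale (r : R) (v : restrict_scalars) : restrict_scalars :=
  phi r *: (v : V).

Fact restrict_scaleA a b v :
  restrict_scale a (restrict_scale b v) = restrict_scale (a * b) v.
Proof. by rewrite /restrict_scale scalerA rmorphM. Qed.
Fact restrict_scale1 : left_id 1 restrict_scale.
Proof. by move=> v; rewrite /restrict_scale rmorph1 scale1r. Qed.
Fact restrict_scaleDr : right_distributive restrict_scale +%R.
Proof. by move=> a u v; rewrite /restrict_scale scalerDr. Qed.
Fact restrict_scaleDl v : {morph restrict_scale^~ v : a b / a + b}.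
Proof. by move=> a b; rewrite /restrict_scale rmorphD scalerDl. Qed.

HB.instance Definition _ := GRing.Zmodule_isLmodule.Build R restrict_scalars
  restrict_scaleA restrict_scale1 restrict_scaleDr restrict_scaleDl.
End RestrictScalars.

(* The tensor product S (x)_R M along phi : R -> S.  Its elements are classes *)
(* of formal sums of pure tensors; no negative coefficients are needed since  *)
(* - (s (x) m) = (- s) (x) m.                                                 *)
Section Tensor.
Variables (R S : pzRingType) (phi : {rmorphism R -> S}) (M : lmodType R).

Inductive tensor_eq : seq (S * M) -> seq (S * M) -> Prop :=
| TensRefl l : tensor_eq l l
| TensSym l1 l2 : tensor_eq l1 l2 -> tensor_eq l2 l1
| TensTrans l1 l2 l3 : tensor_eq l1 l2 -> tensor_eq l2 l3 -> tensor_eq l1 l3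
| TensCat l1 l1' l2 l2' :
    tensor_eq l1 l1' -> tensor_eq l2 l2' -> tensor_eq (l1 ++ l2) (l1' ++ l2')
| TensCatC l1 l2 : tensor_eq (l1 ++ l2) (l2 ++ l1)
| Tens0l m : tensor_eq [:: (0, m)] [::]
| TensDl s s' m : tensor_eq [:: (s + s', m)] [:: (s, m); (s', m)]
| TensDr s m m' : tensor_eq [:: (s, m + m')] [:: (s, m); (s, m')]
| TensBalanced s r m : tensor_eq [:: (s * phi r, m)] [:: (s, r *: m)].

Definition tensor_eqb (l1 l2 : seq (S * M)) : bool := `[< tensor_eq l1 l2 >].

Fact tensor_eqb_refl : reflexive tensor_eqb.
Proof. by move=> l; apply/asboolP/TensRefl. Qed.
Fact tensor_eqb_sym : symmetric tensor_eqb.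
Proof. by move=> l1 l2; apply/asboolP/asboolP; apply: TensSym. Qed.
Fact tensor_eqb_trans : transitive tensor_eqb.
Proof.
by move=> l2 l1 l3 /asboolP h1 /asboolP h2; apply/asboolP/(TensTrans h1 h2).
Qed.

Canonical tensor_equiv :=
  EquivRel tensor_eqb tensor_eqb_refl tensor_eqb_sym tensor_eqb_trans.

Definition tensor : Type := {eq_quot tensor_equiv}.
HB.instance Definition _ := Choice.on tensor.
HB.instance Definition _ := EqQuotient.on tensor.

Definition tens (s : S) (m : M) : tensor := \pi_tensor [:: (s, m)].

Lemma tens_piP l1 l2 : tensor_eq l1 l2 -> \pi_tensor l1 = \pi_tensor l2.
Proof. by move=> h; apply/(@eqmodP _ tensor_equiv)/asboolP. Qed.

Lemma tens_reprP l : tensor_eq (repr (\pi_tensor l)) l.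
Proof. by apply/asboolP/(@eqmodP _ tensor_equiv); rewrite reprK. Qed.

Lemma tensorW (x : tensor) : exists l, x = \pi_tensor l.
Proof. by exists (repr x); rewrite reprK. Qed.

Definition tensor_zero : tensor := \pi_tensor [::].
Definition tensor_add (x y : tensor) : tensor := \pi_tensor (repr x ++ repr y).
Definition tensor_neg (l : seq (S * M)) := [seq (- p.1, p.2) | p <- l].
Definition tensor_opp (x : tensor) : tensor := \pi_tensor (tensor_neg (repr x)).

Lemma tensor_add_pi l1 l2 :
  tensor_add (\pi_tensor l1) (\pi_tensor l2) = \pi_tensor (l1 ++ l2).
Proof. by apply: tens_piP; apply: TensCat; apply: tens_reprP. Qed.

Fact tensor_addA : associative tensor_add.
Proof.
move=> x y z.
have [[l1 ->] [l2 ->] [l3 ->]] := And3 (tensorW x) (tensorW y) (tensorW z).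
rewrite (tensor_add_pi l2 l3) (tensor_add_pi l1 l2).
by rewrite (tensor_add_pi l1) (tensor_add_pi (l1 ++ l2)) catA.
Qed.
Fact tensor_addC : commutative tensor_add.
Proof. by move=> x y; apply: tens_piP; apply: TensCatC. Qed.
Fact tensor_add0 : left_id tensor_zero tensor_add.
Proof. by move=> x; have [l ->] := tensorW x; apply: (tensor_add_pi [::] l). Qed.

Lemma tensor_eq_negK l : tensor_eq (tensor_neg l ++ l) [::].
Proof.
elim: l => [|[s m] l IHl]; first exact: TensRefl.
apply: (@TensTrans _ ([:: (- s, m); (s, m)] ++ (tensor_neg l ++ l))).
  rewrite /= -[_ :: _]/([:: (- s, m)] ++ (tensor_neg l ++ [:: (s, m)] ++ l)).
  rewrite -[_ :: _ :: _]/([:: (- s, m)] ++ ([:: (s, m)] ++ tensor_neg l ++ l)).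
  apply: TensCat; first exact: TensRefl.
  by rewrite !catA; apply: TensCat; [apply: TensCatC | apply: TensRefl].
rewrite -[X in tensor_eq _ X]/([::] ++ [::]); apply: TensCat => //.
by apply: TensTrans (TensSym (TensDl _ _ _)) _; rewrite addNr; apply: Tens0l.
Qed.

Fact tensor_addN : left_inverse tensor_zero tensor_opp tensor_add.
Proof.
move=> x; rewrite -{2}[x]reprK [LHS]tensor_add_pi.
exact/tens_piP/tensor_eq_negK.
Qed.

HB.instance Definition _ := GRing.isZmodule.Build tensor
  tensor_addA tensor_addC tensor_add0 tensor_addN.

Lemma tensDl s s' m : tens (s + s') m = tens s m + tens s' m.
Proof. by rewrite [RHS]tensor_add_pi; apply/tens_piP/TensDl. Qed.
Lemma tensDr s m m' : tens s (m + m') = tens s m + tens s m'.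
Proof. by rewrite [RHS]tensor_add_pi; apply/tens_piP/TensDr. Qed.
Lemma tens_bal s r m : tens (s * phi r) m = tens s (r *: m).
Proof. exact/tens_piP/TensBalanced. Qed.

Lemma tensor_ind (P : tensor -> Prop) :
  (forall s m, P (tens s m)) -> P 0 -> (forall x y, P x -> P y -> P (x + y)) ->
  forall x, P x.
Proof.
move=> Pt P0 PD x; have [l ->] := tensorW x; elim: l => [|[s m] l IHl] //.
have -> : \pi_tensor ((s, m) :: l) = tens s m + \pi_tensor l.
  by rewrite [RHS]tensor_add_pi.
exact: PD.
Qed.

Section Lift.
Variables (V : zmodType) (g : S -> M -> V).

Definition balanced : Prop :=
  [/\ forall s s' m, g (s + s') m = g s m + g s' m,
      forall s m m', g s (m + m') = g s m + g s m'
    & forall s r m, g (s * phi r) m = g s (r *: m)].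

Definition tensor_lift (x : tensor) : V := \sum_(p <- repr x) g p.1 p.2.

Hypothesis g_bal : balanced.

Lemma tensor_lift_pi l :
  tensor_lift (\pi_tensor l) = \sum_(p <- l) g p.1 p.2.
Proof.
have [gDl gDr gb] := g_bal.
have g0 m : g 0 m = 0 by apply: (addrI (g 0 m)); rewrite -gDl !addr0.
suff eq_sum l1 l2 : tensor_eq l1 l2 ->
    \sum_(p <- l1) g p.1 p.2 = \sum_(p <- l2) g p.1 p.2.
  exact: eq_sum (tens_reprP l).
elim=> //.
- by move=> k1 k2 k3 _ -> _ ->.
- by move=> k1 k1' k2 k2' _ IH1 _ IH2; rewrite !big_cat /= IH1 IH2.
- by move=> k1 k2; rewrite !big_cat /= addrC.
- by move=> m; rewrite big_seq1 big_nil g0.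
- by move=> s s' m; rewrite !(big_cons, big_nil) !addr0 gDl.
- by move=> s m m'; rewrite !(big_cons, big_nil) !addr0 gDr.
- by move=> s r m; rewrite !big_seq1 gb.
Qed.

Lemma tensor_lift_tens s m : tensor_lift (tens s m) = g s m.
Proof. by rewrite tensor_lift_pi big_seq1. Qed.

Lemma tensor_lift0 : tensor_lift 0 = 0.
Proof. by rewrite tensor_lift_pi big_nil. Qed.

Lemma tensor_liftD x y : tensor_lift (x + y) = tensor_lift x + tensor_lift y.
Proof.
have [[l1 ->] [l2 ->]] := conj (tensorW x) (tensorW y).
rewrite [_ + _ in LHS](tensor_add_pi l1 l2).
by rewrite !tensor_lift_pi big_cat.
Qed.

End Lift.
End Tensor.

Notation "S '⊗[' phi ']' M" := (@tensor _ S phi M)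
  (at level 40, phi at level 0) : type_scope.

Section ScalarExtension.
Variables (F K : comPzRingType) (j : {rmorphism F -> K}) (A : algType F).

Definition ext_algebra : Type := K ⊗[j] A.
HB.instance Definition _ := GRing.Zmodule.on ext_algebra.

Definition exta (k : K) (a : A) : ext_algebra := tens j k a.

Definition ext_lmul (k : K) (a : A) (u : ext_algebra) : ext_algebra :=
  tensor_lift (fun k' a' => exta (k * k') (a * a')) u.

Definition ext_mul (t u : ext_algebra) : ext_algebra :=
  tensor_lift (fun k a => ext_lmul k a u) t.

Lemma ext_lmul_bal k a :
  balanced j (fun k' (a' : A) => exta (k * k') (a * a')).
Proof.
split=> [s s' b|s b b'|s r b]; rewrite /exta.
- by rewrite mulrDr tensDl.
- by rewrite mulrDr tensDr.
- by rewrite mulrA tens_bal scalerAr.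
Qed.

Lemma ext_lmul_tens k a k' a' :
  ext_lmul k a (exta k' a') = exta (k * k') (a * a').
Proof. exact/tensor_lift_tens/ext_lmul_bal. Qed.

Lemma ext_lmulD k a : {morph ext_lmul k a : u v / u + v}.
Proof. by move=> u v; apply/tensor_liftD/ext_lmul_bal. Qed.

Lemma ext_lmul0 k a : ext_lmul k a 0 = 0.
Proof. exact/tensor_lift0/ext_lmul_bal. Qed.

Lemma ext_mul_bal u : balanced j (fun k (a : A) => ext_lmul k a u).
Proof.
split=> [s s' b|s b b'|s r b].
- elim/tensor_ind: u => [k a||u v IHu IHv]; last 2 first.
  + by rewrite !ext_lmul0 addr0.
  + by rewrite !ext_lmulD IHu IHv addrACA.
  by rewrite !ext_lmul_tens mulrDl /exta tensDl.
- elim/tensor_ind: u => [k a||u v IHu IHv]; last 2 first.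
  + by rewrite !ext_lmul0 addr0.
  + by rewrite !ext_lmulD IHu IHv addrACA.
  by rewrite !ext_lmul_tens mulrDl /exta tensDr.
- elim/tensor_ind: u => [k a||u v IHu IHv]; last 2 first.
  + by rewrite !ext_lmul0.
  + by rewrite !ext_lmulD IHu IHv.
  by rewrite !ext_lmul_tens -scalerAl /exta -tens_bal mulrAC.
Qed.

Lemma exta_mul k a k' a' :
  ext_mul (exta k a) (exta k' a') = exta (k * k') (a * a').
Proof.
by rewrite -ext_lmul_tens; apply/tensor_lift_tens/ext_mul_bal.
Qed.

Fact ext_mulDl : left_distributive ext_mul +%R.
Proof. by move=> t t' u; apply/tensor_liftD/ext_mul_bal. Qed.

Fact ext_mul0l u : ext_mul 0 u = 0.
Proof. exact/tensor_lift0/ext_mul_bal. Qed.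

Fact ext_mulDr : right_distributive ext_mul +%R.
Proof.
move=> t u v; elim/tensor_ind: t => [k a||t t' IHt IHt'].
- by rewrite /ext_mul !(tensor_lift_tens (ext_mul_bal _)) ext_lmulD.
- by rewrite !ext_mul0l addr0.
- by rewrite !ext_mulDl IHt IHt' addrACA.
Qed.

Fact ext_mul0r u : ext_mul u 0 = 0.
Proof. by apply: (addrI (ext_mul u 0)); rewrite -ext_mulDr !addr0. Qed.

Fact ext_mulA : associative ext_mul.
Proof.
move=> t u v; elim/tensor_ind: t => [k a||t t' IHt IHt']; last 2 first.
- by rewrite !ext_mul0l.
- by rewrite !ext_mulDl IHt IHt'.
elim/tensor_ind: u => [k' a'||u u' IHu IHu']; last 2 first.
- by rewrite !(ext_mul0l, ext_mul0r).
- by rewrite !(ext_mulDl, ext_mulDr) IHu IHu'.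
elim/tensor_ind: v => [k'' a''||v v' IHv IHv']; last 2 first.
- by rewrite !ext_mul0r.
- by rewrite !ext_mulDr IHv IHv'.
by rewrite !exta_mul !mulrA.
Qed.

Fact ext_mul1l : left_id (exta 1 1) ext_mul.
Proof.
elim/tensor_ind=> [k a||u v IHu IHv].
- by rewrite exta_mul !mul1r.
- exact: ext_mul0r.
- by rewrite ext_mulDr IHu IHv.
Qed.

Fact ext_mul1r : right_id (exta 1 1) ext_mul.
Proof.
elim/tensor_ind=> [k a||u v IHu IHv].
- by rewrite exta_mul !mulr1.
- exact: ext_mul0l.
- by rewrite ext_mulDl IHu IHv.
Qed.

HB.instance Definition _ := GRing.Zmodule_isPzRing.Build ext_algebra
  ext_mulA ext_mul1l ext_mul1r ext_mulDl ext_mulDr.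

Lemma extaM k a k' a' : exta k a * exta k' a' = exta (k * k') (a * a').
Proof. exact: exta_mul. Qed.

Definition ext_scalar (k : K) : ext_algebra := exta k 1.

Fact ext_scalar_zmod : zmod_morphism ext_scalar.
Proof.
move=> k k'; apply: (addIr (ext_scalar k')).
by rewrite subrK -[LHS]tensDl subrK.
Qed.
Fact ext_scalar_monoid : monoid_morphism ext_scalar.
Proof. by split=> // k k'; rewrite /ext_scalar extaM mulr1. Qed.

HB.instance Definition _ :=
  GRing.isZmodMorphism.Build K ext_algebra ext_scalar ext_scalar_zmod.
HB.instance Definition _ :=
  GRing.isMonoidMorphism.Build K ext_algebra ext_scalar ext_scalar_monoid.

End ScalarExtension.

Section IntermediateFields.
Variables (F E : fieldType) (iota : {rmorphism F -> E}).

(* Boolean predicates lose no generality: by the classical axioms of boolp    *)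
(* every subset of E is the extension of one.                                 *)
Record intermediate_field : Type := IntermediateField {
  intermediate_pred :> divringClosed E;
  intermediate_base : forall c : F, iota c \in intermediate_pred
}.

Variable L : intermediate_field.

Record subfield_of : Type := SubfieldOf {
  subfield_val : E;
  _ : subfield_val \in (L : {pred E})
}.

HB.instance Definition _ := [isSub for subfield_val].
HB.instance Definition _ := [Choice of subfield_of by <:].
HB.instance Definition _ := [SubChoice_isSubComUnitRing of subfield_of by <:].
HB.instance Definition _ :=
  [SubComUnitRing_isSubIntegralDomain of subfield_of by <:].
HB.instance Definition _ := [SubIntegralDomain_isSubField of subfield_of by <:].

Definition subfield_incl (x : subfield_of) : E := val x.

Fact subfield_incl_zmod : zmod_morphism subfield_incl.
Proof. exact: raddfB. Qed.
Fact subfield_incl_monoid : monoid_morphism subfield_incl.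
Proof. by split; [apply: rmorph1 | apply: rmorphM]. Qed.

HB.instance Definition _ :=
  GRing.isZmodMorphism.Build subfield_of E subfield_incl subfield_incl_zmod.
HB.instance Definition _ :=
  GRing.isMonoidMorphism.Build subfield_of E subfield_incl subfield_incl_monoid.

Definition base_incl (c : F) : subfield_of :=
  SubfieldOf (intermediate_base L c).

Fact base_incl_zmod : zmod_morphism base_incl.
Proof. by move=> c d; apply: val_inj; rewrite raddfB /= raddfB. Qed.
Fact base_incl_monoid : monoid_morphism base_incl.
Proof.
by split=> [|c d]; apply: val_inj; rewrite ?rmorph1 ?rmorphM //= ?rmorph1 ?rmorphM.
Qed.

HB.instance Definition _ :=
  GRing.isZmodMorphism.Build F subfield_of base_incl base_incl_zmod.
HB.instance Definition _ :=
  GRing.isMonoidMorphism.Build F subfield_of base_incl base_incl_monoid.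

(* E (x)_L M0 with its A_E-module structure, where (e (x) a) acts by          *)
(* e' (x) m |-> e e' (x) (1 (x) a) m.                                         *)
Section BaseChange.
Variables (A : algType F) (M0 : lmodType (ext_algebra base_incl A)).

Local Notation M0_L := (restrict_scalars (ext_scalar base_incl A) M0).

Definition base_change : Type := E ⊗[subfield_incl] M0_L.
HB.instance Definition _ := GRing.Zmodule.on base_change.

Definition base_tens (e : E) (m : M0) : base_change :=
  tens (M := M0_L) subfield_incl e m.

Definition base_act (e : E) (a : A) (u : base_change) : base_change :=
  tensor_lift (M := M0_L)
    (fun e' (m : M0) => base_tens (e * e') (exta base_incl 1 a *: m)) u.

Definition base_scale (t : ext_algebra iota A) (u : base_change) : base_change :=
  tensor_lift (fun e a => base_act e a u) t.

Lemma base_act_bal (e : E) (a : A) :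
  balanced (M := M0_L) subfield_incl
    (fun e' (m : M0) => base_tens (e * e') (exta base_incl 1 a *: m)).
Proof.
split=> [s s' m|s m m'|s r m]; rewrite /base_tens.
- by rewrite mulrDr tensDl.
- by rewrite scalerDr tensDr.
- rewrite mulrA tens_bal; congr tens.
  rewrite -[RHS]/(exta base_incl 1 a *: (exta base_incl r 1 *: (m : M0))).
  rewrite -[LHS]/(exta base_incl r 1 *: (exta base_incl 1 a *: (m : M0))).
  by rewrite !scalerA !extaM !(mulr1, mul1r).
Qed.

Lemma base_act_tens e a e' m :
  base_act e a (base_tens e' m) = base_tens (e * e') (exta base_incl 1 a *: m).
Proof. exact/tensor_lift_tens/base_act_bal. Qed.

Lemma base_actD e a : {morph base_act e a : u v / u + v}.
Proof. by move=> u v; apply/tensor_liftD/base_act_bal. Qed.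

Lemma base_act0 e a : base_act e a 0 = 0.
Proof. exact/tensor_lift0/base_act_bal. Qed.

Lemma base_scale_bal u : balanced iota (fun e (a : A) => base_act e a u).
Proof.
split=> [s s' b|s b b'|s r b].
- elim/tensor_ind: u => [e m||u v IHu IHv]; last 2 first.
  + by rewrite !base_act0 addr0.
  + by rewrite !base_actD IHu IHv addrACA.
  rewrite -/(base_tens e m) !base_act_tens.
  by rewrite mulrDl /base_tens tensDl.
- elim/tensor_ind: u => [e m||u v IHu IHv]; last 2 first.
  + by rewrite !base_act0 addr0.
  + by rewrite !base_actD IHu IHv addrACA.
  rewrite -/(base_tens e m) !base_act_tens.
  have -> : exta base_incl 1 (b + b') = exta base_incl 1 b + exta base_incl 1 b'.
    exact: tensDr.
  by rewrite scalerDl /base_tens tensDr.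
- elim/tensor_ind: u => [e m||u v IHu IHv]; last 2 first.
  + by rewrite !base_act0.
  + by rewrite !base_actD IHu IHv.
  rewrite -/(base_tens e m) !base_act_tens.
  have -> : s * iota r * e = s * e * subfield_incl (base_incl r).
    by rewrite mulrAC.
  rewrite /base_tens tens_bal; congr tens.
  rewrite -[LHS]/(exta base_incl (base_incl r) 1 *: (exta base_incl 1 b *: m)).
  have -> : exta base_incl 1 (r *: b) = exta base_incl (base_incl r) b.
    by rewrite /exta -tens_bal mul1r.
  by rewrite scalerA extaM mulr1 mul1r.
Qed.

Lemma base_scale_tens e a u : base_scale (exta iota e a) u = base_act e a u.
Proof. exact/tensor_lift_tens/base_scale_bal. Qed.

Fact base_scaleDl u : {morph base_scale^~ u : t t' / t + t'}.
Proof. by move=> t t'; apply/tensor_liftD/base_scale_bal. Qed.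

Fact base_scale0l u : base_scale 0 u = 0.
Proof. exact/tensor_lift0/base_scale_bal. Qed.

Fact base_scaleDr : right_distributive base_scale +%R.
Proof.
move=> t u v; elim/tensor_ind: t => [e a||t t' IHt IHt'].
- by rewrite -/(exta iota e a) !base_scale_tens base_actD.
- by rewrite !base_scale0l addr0.
- by rewrite !base_scaleDl IHt IHt' addrACA.
Qed.

Fact base_scale0r t : base_scale t 0 = 0.
Proof. by apply: (addrI (base_scale t 0)); rewrite -base_scaleDr !addr0. Qed.

Fact base_scaleA t t' u : base_scale t (base_scale t' u) = base_scale (t * t') u.
Proof.
elim/tensor_ind: t => [e a||t s IHt IHs]; last 2 first.
- by rewrite mul0r !base_scale0l.
- by rewrite mulrDl !base_scaleDl IHt IHs.
elim/tensor_ind: t' => [e' a'||t s IHt IHs]; last 2 first.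
- by rewrite mulr0 !(base_scale0l, base_scale0r).
- by rewrite mulrDr !(base_scaleDl, base_scaleDr) IHt IHs.
elim/tensor_ind: u => [d m||u v IHu IHv]; last 2 first.
- by rewrite !base_scale0r.
- by rewrite !base_scaleDr IHu IHv.
rewrite -/(exta iota e a) -/(exta iota e' a') -/(base_tens d m) extaM.
by rewrite !base_scale_tens !base_act_tens scalerA extaM mulr1 mulrA.
Qed.

Fact base_scale1 : left_id 1 base_scale.
Proof.
elim/tensor_ind=> [e m||u v IHu IHv].
- rewrite -/(base_tens e m) base_scale_tens base_act_tens mul1r.
  exact: congr1 (scale1r m).
- exact: base_scale0r.
- by rewrite base_scaleDr IHu IHv.
Qed.

HB.instance Definition _ :=
  GRing.Zmodule_isLmodule.Build (ext_algebra iota A) base_change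
    base_scaleA base_scale1 base_scaleDr base_scaleDl.

End BaseChange.
End IntermediateFields.

Section FieldsOfDefinition.
Variables (F E : fieldType) (iota : {rmorphism F -> E}).

Definition alg_independent (n : nat) (t : 'I_n -> E) : Prop :=
  forall p : mpoly.mpoly n F, mpoly.mmap iota t p = 0 -> p = 0.

(* No n satisfies this when L has infinite transcendence degree over F. *)
Definition trdeg_eq (L : intermediate_field iota) (n : nat) : Prop :=
  (exists t : 'I_n -> E, (forall i, t i \in L) /\ alg_independent t) /\
  (forall m (t : 'I_m -> E),
     (forall i, t i \in L) -> alg_independent t -> (m <= n)%N).

Variables (A : algType F) (M : lmodType (ext_algebra iota A)).

Definition field_of_definition (L : intermediate_field iota) : Prop :=
  exists M0 : lmodType (ext_algebra (@base_incl _ _ _ L) A),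
    finitely_generated M0 /\ lmod_isomorphic M (base_change M0).

Definition minimal_field_of_definition (L : intermediate_field iota) : Prop :=
  field_of_definition L /\
  forall L' : intermediate_field iota,
    field_of_definition L' -> {subset L <= L'}.

Definition ed_eq (d : nat) : Prop :=
  (exists2 L : intermediate_field iota, field_of_definition L & trdeg_eq L d) /\
  (forall (L : intermediate_field iota) (n : nat),
     field_of_definition L -> trdeg_eq L n -> (d <= n)%N).

End FieldsOfDefinition.


(* Q[a,b] is rendered as Q[a][b]: the inner variable is a, the outer one b.   *)
Definition conic_poly : {poly {poly rat}} := 'X^2 + ('X^2 + 1)%:P.

Lemma size_conic_poly : size conic_poly = 3%N.
Proof. exact: size_XnaddC. Qed.

Lemma monic_conic_poly : conic_poly \is monic.
Proof. exact: monicXnaddC. Qed.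

Lemma mk_monic_conic : mk_monic conic_poly = conic_poly.
Proof. by rewrite /mk_monic size_conic_poly monic_conic_poly. Qed.

Definition conic_ring : Type := {poly %/ conic_poly}.
HB.instance Definition _ := GRing.ComNzRing.on conic_ring.

Definition conic_lift (q : conic_ring) : {poly {poly rat}} :=
  polyn (q : {poly %/ conic_poly}).

Definition conic_norm (q : conic_ring) : {poly rat} :=
  (conic_lift q)`_0 ^+ 2 + ('X^2 + 1) * (conic_lift q)`_1 ^+ 2.

Lemma conic_ring_repr (q : conic_ring) :
  conic_lift q = ((conic_lift q)`_0)%:P + (conic_lift q)`_1 *: 'X.
Proof.
have := size_mk_monic (q : {poly %/ conic_poly}); rewrite -/(conic_lift q).
rewrite mk_monic_conic size_conic_poly ltnS => sq.
apply/polyP => i; rewrite coefD coefC coefZ coefX.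
case: i => [|[|i]] /=; rewrite ?mulr0 ?addr0 ?mulr1 ?add0r //.
by rewrite nth_default // (leq_trans sq).
Qed.

Lemma conic_ring_mul (p q : conic_ring) :
  let p0 := (conic_lift p)`_0 in let p1 := (conic_lift p)`_1 in
  let q0 := (conic_lift q)`_0 in let q1 := (conic_lift q)`_1 in
  conic_lift (p * q) =
    (p0 * q0 - p1 * q1 * ('X^2 + 1))%:P + (p0 * q1 + p1 * q0) *: 'X.
Proof.
move=> p0 p1 q0 q1; rewrite -[LHS]/(Pdiv.CommonRing.rmodp
  (conic_lift p * conic_lift q) (mk_monic conic_poly)).
rewrite mk_monic_conic (conic_ring_repr p) (conic_ring_repr q).
rewrite -/p0 -/p1 -/q0 -/q1.
have -> : (p0%:P + p1 *: 'X) * (q0%:P + q1 *: 'X) =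
    (p1 * q1)%:P * conic_poly + ((p0 * q0 - p1 * q1 * ('X^2 + 1))%:P
    + (p0 * q1 + p1 * q0) *: 'X).
  rewrite -!mul_polyC !(polyCD, polyCN, polyCM) /conic_poly polyCD; ring.
rewrite Pdiv.RingMonic.rmodp_addl_mul_small ?monic_conic_poly //.
rewrite size_conic_poly ltnS; apply: leq_trans (size_polyD _ _) _.
rewrite geq_max (leq_trans (size_polyC_leq1 _)) //=.
by rewrite (leq_trans (size_scale_leq _ _)) ?size_polyX.
Qed.

Lemma conic_normM p q : conic_norm (p * q) = conic_norm p * conic_norm q.
Proof.
rewrite /conic_norm conic_ring_mul !coefD !coefC !coefZ !coefX /=.
rewrite !mulr0 !addr0 !mulr1 !add0r.
ring.
Qed.

Lemma conic_norm_eq0 p : conic_norm p = 0 -> p = 0.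
Proof.
move=> Np0.
have ev (x : rat) : ((conic_lift p)`_0).[x] = 0 /\ ((conic_lift p)`_1).[x] = 0.
  have h : ((conic_lift p)`_0).[x] ^+ 2
      + (x ^+ 2 + 1) * ((conic_lift p)`_1).[x] ^+ 2 = 0.
    have := congr1 (horner^~ x) Np0; rewrite /conic_norm horner0 !expr2.
    by rewrite !(hornerD, hornerM, hornerX, hornerC).
  have lt0 : 0 < x ^+ 2 + 1 by rewrite ltr_wpDl ?sqr_ge0.
  have h1 : 0 <= (x ^+ 2 + 1) * ((conic_lift p)`_1).[x] ^+ 2.
    by apply: mulr_ge0; [apply: ltW | apply: sqr_ge0].
  move/eqP: h; rewrite (paddr_eq0 (sqr_ge0 _) h1).
  by rewrite [X in _ && X]mulf_eq0 (gt_eqF lt0) /= !sqrf_eq0 => /andP[/eqP -> /eqP ->].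
have z (r : {poly rat}) : (forall x, r.[x] = 0) -> r = 0.
  move=> r0; apply/eqP/negPn/negP => nz_r.
  have := @max_poly_roots _ r [seq i%:R | i <- iota 0 (size r)] nz_r.
  rewrite size_map size_iota ltnn => h; suff: false by []; apply: h.
  - by apply/allP => x _; apply/rootP.
  - by rewrite map_inj_uniq ?iota_uniq // => i k /eqP; rewrite eqr_nat => /eqP.
apply/val_inj; rewrite /= -/(conic_lift p) (conic_ring_repr p).
have [-> ->] : (conic_lift p)`_0 = 0 /\ (conic_lift p)`_1 = 0.
  by split; apply: z => x; case: (ev x).
by rewrite scale0r addr0.
Qed.

Definition conic_unit : pred conic_ring :=
  fun x => `[< exists y : conic_ring, y * x = 1 >].

Definition conic_inv (x : conic_ring) : conic_ring :=
  if pselect (exists y : conic_ring, y * x = 1) is left h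
  then projT1 (cid h) else x.

Fact conic_mulVr : {in conic_unit, left_inverse 1 conic_inv *%R}.
Proof.
by move=> x /asboolP h; rewrite /conic_inv; case: pselect => // h'; case: cid.
Qed.
Fact conic_unitP (x y : conic_ring) : y * x = 1 -> conic_unit x.
Proof. by move=> h; apply/asboolP; exists y. Qed.
Fact conic_inv_out : {in [predC conic_unit], conic_inv =1 id}.
Proof.
move=> x /asboolP h; rewrite /conic_inv; case: pselect => // h'.
Qed.

HB.instance Definition _ := GRing.ComNzRing_hasMulInverse.Build conic_ring
  conic_mulVr conic_unitP conic_inv_out.

Fact conic_idomain (x y : conic_ring) : x * y = 0 -> (x == 0) || (y == 0).
Proof.
move=> xy0; have /eqP : conic_norm x * conic_norm y = 0.
  by rewrite -conic_normM xy0 /conic_norm !coef0 expr0n mulr0 addr0.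
by rewrite mulf_eq0 => /orP[] /eqP/conic_norm_eq0 ->; rewrite eqxx ?orbT.
Qed.

HB.instance Definition _ :=
  GRing.ComUnitRing_isIntegral.Build conic_ring conic_idomain.

Definition conic_field : fieldType := {fraction conic_ring}.

Section QuotientAlgebra.
Variables (F : comPzRingType) (R : algType F) (rel : R -> Prop).

Inductive two_sided_ideal : R -> Prop :=
| IdealGen u : rel u -> two_sided_ideal u
| Ideal0 : two_sided_ideal 0
| IdealD u v : two_sided_ideal u -> two_sided_ideal v -> two_sided_ideal (u + v)
| IdealM a u b : two_sided_ideal u -> two_sided_ideal (a * u * b).

Definition ideal_eqb (u v : R) : bool := `[< two_sided_ideal (u - v) >].

Lemma two_sided_idealN u : two_sided_ideal u -> two_sided_ideal (- u).
Proof. by move/(IdealM (-1) 1); rewrite mulr1 mulN1r. Qed.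

Fact ideal_eqb_refl : reflexive ideal_eqb.
Proof. by move=> u; apply/asboolP; rewrite subrr; apply: Ideal0. Qed.
Fact ideal_eqb_sym : symmetric ideal_eqb.
Proof.
by move=> u v; apply/asboolP/asboolP => /two_sided_idealN; rewrite opprB.
Qed.
Fact ideal_eqb_trans : transitive ideal_eqb.
Proof.
move=> v u w /asboolP h1 /asboolP h2; apply/asboolP.
by have := IdealD h1 h2; rewrite addrA subrK.
Qed.

Canonical ideal_equiv :=
  EquivRel ideal_eqb ideal_eqb_refl ideal_eqb_sym ideal_eqb_trans.

Definition quot_alg : Type := {eq_quot ideal_equiv}.
HB.instance Definition _ := Choice.on quot_alg.
HB.instance Definition _ := EqQuotient.on quot_alg.

Definition quot_cl (u : R) : quot_alg := \pi_quot_alg u.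

Lemma quot_clP u v : quot_cl u = quot_cl v <-> two_sided_ideal (u - v).
Proof.
split=> [h|h]; first by apply/asboolP/(@eqmodP _ ideal_equiv).
by apply/(@eqmodP _ ideal_equiv)/asboolP.
Qed.

Lemma quot_repr u : two_sided_ideal (repr (quot_cl u) - u).
Proof. by apply/quot_clP; rewrite /quot_cl reprK. Qed.

Lemma quotW (x : quot_alg) : exists u, x = quot_cl u.
Proof. by exists (repr x); rewrite /quot_cl reprK. Qed.

Definition quot_add (x y : quot_alg) : quot_alg := quot_cl (repr x + repr y).
Definition quot_opp (x : quot_alg) : quot_alg := quot_cl (- repr x).
Definition quot_mul (x y : quot_alg) : quot_alg := quot_cl (repr x * repr y).
Definition quot_scale (c : F) (x : quot_alg) : quot_alg := quot_cl (c *: repr x).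

Lemma quot_clD u v : quot_add (quot_cl u) (quot_cl v) = quot_cl (u + v).
Proof.
apply/quot_clP; rewrite opprD addrACA.
by apply: IdealD; apply: quot_repr.
Qed.
Lemma quot_clN u : quot_opp (quot_cl u) = quot_cl (- u).
Proof.
by apply/quot_clP; rewrite -opprD; apply/two_sided_idealN/quot_repr.
Qed.
Lemma quot_clM u v : quot_mul (quot_cl u) (quot_cl v) = quot_cl (u * v).
Proof.
apply/quot_clP; set u' := repr _; set v' := repr _.
have -> : u' * v' - u * v = 1 * (u' - u) * v' + u * (v' - v) * 1.
  by rewrite mul1r mulr1 mulrBl mulrBr addrA subrK.
by apply: IdealD; apply/IdealM/quot_repr.
Qed.
Lemma quot_clZ c u : quot_scale c (quot_cl u) = quot_cl (c *: u).
Proof.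
apply/quot_clP; rewrite -scalerBr -[_ - u]mulr1 -[_ - u]mul1r scalerAl scalerAl.
by apply/IdealM/quot_repr.
Qed.

Fact quot_addA : associative quot_add.
Proof.
move=> x y z; have [u ->] := quotW x; have [v ->] := quotW y.
have [w ->] := quotW z.
by rewrite (quot_clD v w) (quot_clD u) (quot_clD u v) (quot_clD _ w) addrA.
Qed.
Fact quot_addC : commutative quot_add.
Proof. by move=> x y; rewrite /quot_add addrC. Qed.
Fact quot_add0 : left_id (quot_cl 0) quot_add.
Proof. by move=> x; have [u ->] := quotW x; rewrite (quot_clD 0 u) add0r. Qed.
Fact quot_addN : left_inverse (quot_cl 0) quot_opp quot_add.
Proof.
by move=> x; have [u ->] := quotW x; rewrite quot_clN (quot_clD _ u) addNr.
Qed.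

HB.instance Definition _ := GRing.isZmodule.Build quot_alg
  quot_addA quot_addC quot_add0 quot_addN.

Fact quot_mulA : associative quot_mul.
Proof.
move=> x y z; have [u ->] := quotW x; have [v ->] := quotW y.
have [w ->] := quotW z.
by rewrite (quot_clM v w) (quot_clM u) (quot_clM u v) (quot_clM _ w) mulrA.
Qed.
Fact quot_mul1l : left_id (quot_cl 1) quot_mul.
Proof. by move=> x; have [u ->] := quotW x; rewrite (quot_clM 1 u) mul1r. Qed.
Fact quot_mul1r : right_id (quot_cl 1) quot_mul.
Proof. by move=> x; have [u ->] := quotW x; rewrite (quot_clM u 1) mulr1. Qed.
Fact quot_mulDl : left_distributive quot_mul +%R.
Proof.
move=> x y z; have [u ->] := quotW x; have [v ->] := quotW y.
have [w ->] := quotW z.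
rewrite [quot_cl u + _](quot_clD u v) (quot_clM _ w) (quot_clM u w) (quot_clM v w).
by rewrite [RHS](quot_clD (u * w)) mulrDl.
Qed.
Fact quot_mulDr : right_distributive quot_mul +%R.
Proof.
move=> x y z; have [u ->] := quotW x; have [v ->] := quotW y.
have [w ->] := quotW z.
rewrite [quot_cl v + _](quot_clD v w) (quot_clM u) (quot_clM u w) (quot_clM u v).
by rewrite [RHS](quot_clD (u * v)) mulrDr.
Qed.

HB.instance Definition _ := GRing.Zmodule_isPzRing.Build quot_alg
  quot_mulA quot_mul1l quot_mul1r quot_mulDl quot_mulDr.

Fact quot_scaleA a b x : quot_scale a (quot_scale b x) = quot_scale (a * b) x.
Proof.
by have [u ->] := quotW x; rewrite (quot_clZ b u) (quot_clZ a) (quot_clZ _ u) scalerA.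
Qed.
Fact quot_scale1 : left_id 1 quot_scale.
Proof. by move=> x; have [u ->] := quotW x; rewrite (quot_clZ 1 u) scale1r. Qed.
Fact quot_scaleDr : right_distributive quot_scale +%R.
Proof.
move=> c x y; have [u ->] := quotW x; have [v ->] := quotW y.
rewrite [quot_cl u + _](quot_clD u v) (quot_clZ c) (quot_clZ c u) (quot_clZ c v).
by rewrite [RHS](quot_clD (c *: u)) scalerDr.
Qed.
Fact quot_scaleDl x : {morph quot_scale^~ x : a b / a + b}.
Proof.
move=> a b; have [u ->] := quotW x.
rewrite (quot_clZ a u) (quot_clZ b u) (quot_clZ _ u).
by rewrite [RHS](quot_clD (a *: u)) scalerDl.
Qed.

HB.instance Definition _ := GRing.Zmodule_isLmodule.Build F quot_alg
  quot_scaleA quot_scale1 quot_scaleDr quot_scaleDl.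

Fact quot_scaleAl (c : F) (x y : quot_alg) : c *: (x * y) = c *: x * y.
Proof.
have [u ->] := quotW x; have [v ->] := quotW y.
rewrite [quot_cl u * _](quot_clM u v) [LHS](quot_clZ c).
by rewrite [c *: quot_cl u](quot_clZ c u) [RHS](quot_clM _ v) scalerAl.
Qed.
Fact quot_scaleAr (c : F) (x y : quot_alg) : c *: (x * y) = x * (c *: y).
Proof.
have [u ->] := quotW x; have [v ->] := quotW y.
rewrite [quot_cl u * _](quot_clM u v) [LHS](quot_clZ c).
by rewrite [c *: quot_cl v](quot_clZ c v) [RHS](quot_clM u) scalerAr.
Qed.

Lemma quot_clD_ring u v : quot_cl (u + v) = quot_cl u + quot_cl v.
Proof. exact/esym/quot_clD. Qed.
Lemma quot_clM_ring u v : quot_cl (u * v) = quot_cl u * quot_cl v.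
Proof. exact/esym/quot_clM. Qed.
Lemma quot_clZ_ring c u : quot_cl (c *: u) = c *: quot_cl u.
Proof. exact/esym/quot_clZ. Qed.

End QuotientAlgebra.

Lemma malg_scaleAr (K : monomType) (R : comNzRingType) (c : R)
  (u v : {malg R[K]}) : c *: (u * v) = u * (c *: v).
Proof.
apply/malgP => k; rewrite mcoeffZ.
rewrite (mcoeffMlw k (fsubset_refl (msupp u)) (msuppZ_le c v)) mcoeffMl.
rewrite mulr_sumr; apply: eq_bigr => i _; rewrite mulr_sumr; apply: eq_bigr => l _.
by rewrite mcoeffZ mulrnAr mulrCA.
Qed.

(* Q{x,y}: the letters x and y are true and false.                            *)
Definition free_alg : Type := {malg rat[{fmonom bool}]}.
HB.instance Definition _ := GRing.Lalgebra.on free_alg.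

Fact free_alg_scaleAr (c : rat) (u v : free_alg) : c *: (u * v) = u * (c *: v).
Proof. exact: malg_scaleAr. Qed.

HB.instance Definition _ :=
  GRing.Lalgebra_isAlgebra.Build rat free_alg free_alg_scaleAr.

Definition free_x : free_alg := mkmalgU (fmu true) 1.
Definition free_y : free_alg := mkmalgU (fmu false) 1.

Definition quaternion_relation (u : free_alg) : Prop :=
  [\/ u = free_x ^+ 2 + 1, u = free_y ^+ 2 + 1
    | u = free_x * free_y + free_y * free_x].

Definition quaternion : Type := quot_alg quaternion_relation.
HB.instance Definition _ := GRing.PzRing.on quaternion.
HB.instance Definition _ := GRing.Lmodule.on quaternion.


Definition conic_in (p : {poly {poly rat}}) : conic_field :=
  tofrac (in_qpoly conic_poly p : conic_ring).

Fact conic_in_zmod : zmod_morphism conic_in.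
Proof. by move=> p q; rewrite /conic_in !raddfB. Qed.
Fact conic_in_monoid : monoid_morphism conic_in.
Proof.
split=> [|p q]; first by rewrite /conic_in in_qpoly1 tofrac1.
by rewrite /conic_in in_qpolyM -tofracM.
Qed.

HB.instance Definition _ :=
  GRing.isZmodMorphism.Build {poly {poly rat}} conic_field conic_in conic_in_zmod.
HB.instance Definition _ :=
  GRing.isMonoidMorphism.Build {poly {poly rat}} conic_field conic_in
    conic_in_monoid.

Definition conic_a : conic_field := conic_in ('X%:P).
Definition conic_b : conic_field := conic_in 'X.
Definition conic_rat (c : rat) : conic_field := conic_in (c%:P%:P).

Fact conic_rat_zmod : zmod_morphism conic_rat.
Proof. by move=> c d; rewrite /conic_rat !raddfB. Qed.
Fact conic_rat_monoid : monoid_morphism conic_rat.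
Proof.
split=> [|c d]; first by rewrite /conic_rat !rmorph1.
by rewrite /conic_rat !polyCM rmorphM.
Qed.

HB.instance Definition _ :=
  GRing.isZmodMorphism.Build rat conic_field conic_rat conic_rat_zmod.
HB.instance Definition _ :=
  GRing.isMonoidMorphism.Build rat conic_field conic_rat conic_rat_monoid.

Lemma conic_eq : conic_a ^+ 2 + conic_b ^+ 2 = -1.
Proof.
apply/eqP; rewrite -subr_eq0 opprK; apply/eqP.
have -> : conic_a ^+ 2 + conic_b ^+ 2 + 1 = conic_in conic_poly.
  rewrite /conic_poly polyCD polyC_exp !rmorphD /= !rmorphXn /= rmorph1.
  by rewrite addrA [X in X + 1]addrC.
rewrite /conic_in -[RHS]tofrac0; congr tofrac; apply: val_inj.
by rewrite /= mk_monic_conic Pdiv.RingMonic.rmodpp ?monic_conic_poly.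
Qed.

Definition mx22 (K : fieldType) (p q r s : K) : 'M[K]_2 :=
  \matrix_(i < 2, j < 2) nth 0 (nth [::] [:: [:: p; q]; [:: r; s]] i) j.

Definition mx_x : 'M[conic_field]_2 := mx22 conic_a conic_b conic_b (- conic_a).
Definition mx_y : 'M[conic_field]_2 :=
  mx22 conic_b (- conic_a) (- conic_a) (- conic_b).

Lemma mx22M (K : fieldType) (p q r s p' q' r' s' : K) :
  mx22 p q r s * mx22 p' q' r' s' =
  mx22 (p * p' + q * r') (p * q' + q * s') (r * p' + s * r') (r * q' + s * s').
Proof.
apply/matrixP => i j; rewrite !mxE !big_ord_recl big_ord0 addr0 !mxE /=.
by case: i j => [[|[|i]] hi] [[|[|j]] hj].
Qed.

Lemma mx22D (K : fieldType) (p q r s p' q' r' s' : K) :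
  mx22 p q r s + mx22 p' q' r' s' = mx22 (p + p') (q + q') (r + r') (s + s').
Proof.
by apply/matrixP => i j; rewrite !mxE; case: i j => [[|[|i]] hi] [[|[|j]] hj].
Qed.

Lemma mx22_1 (K : fieldType) : mx22 1 0 0 1 = 1 :> 'M[K]_2.
Proof.
by apply/matrixP => i j; rewrite !mxE; case: i j => [[|[|i]] hi] [[|[|j]] hj].
Qed.

Lemma mx22_0 (K : fieldType) : mx22 0 0 0 0 = 0 :> 'M[K]_2.
Proof.
by apply/matrixP => i j; rewrite !mxE; case: i j => [[|[|i]] hi] [[|[|j]] hj].
Qed.

Section QuaternionMatrices.
Variables (K : fieldType) (a b : K).
Hypothesis ab : a ^+ 2 + b ^+ 2 = -1.
Let x := mx22 a b b (- a).
Let y := mx22 b (- a) (- a) (- b).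

Lemma mx22_xx : x ^+ 2 + 1 = 0.
Proof.
rewrite expr2 mx22M -mx22_1 mx22D -mx22_0.
have e : a * a + b * b + 1 = 0 by rewrite -!expr2 ab addNr.
by congr mx22; rewrite -?e; ring.
Qed.

Lemma mx22_yy : y ^+ 2 + 1 = 0.
Proof.
rewrite expr2 mx22M -mx22_1 mx22D -mx22_0.
have e : a * a + b * b + 1 = 0 by rewrite -!expr2 ab addNr.
by congr mx22; rewrite -?e; ring.
Qed.

Lemma mx22_xy : x * y + y * x = 0.
Proof. by rewrite !mx22M mx22D -mx22_0; congr mx22; ring. Qed.
End QuaternionMatrices.

Definition mx_word (w : {fmonom bool}) : 'M[conic_field]_2 :=
  \prod_(l <- (w : seq bool)) (if l then mx_x else mx_y).

Fact mx_word_mmorphism : mmorphism mx_word.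
Proof.
split=> [u v|]; rewrite /mx_word.
  have -> : monalg.mul u v = FMonom (u ++ v) by apply: fmmulE.
  by rewrite big_cat.
have -> : monalg.one = FMonom [::] :> {fmonom bool} by apply: fmoneE.
by rewrite big_nil.
Qed.
HB.instance Definition _ :=
  monalg.isMultiplicative.Build {fmonom bool} 'M[conic_field]_2 mx_word
    mx_word_mmorphism.

Definition mx_rat (c : rat) : 'M[conic_field]_2 := (conic_rat c)%:M.

Fact mx_rat_zmod : zmod_morphism mx_rat.
Proof. by move=> c d; rewrite /mx_rat !raddfB. Qed.
Fact mx_rat_monoid : monoid_morphism mx_rat.
Proof.
split=> [|c d]; first by rewrite /mx_rat rmorph1.
by rewrite /mx_rat rmorphM scalar_mxM.
Qed.

HB.instance Definition _ :=
  GRing.isZmodMorphism.Build rat 'M[conic_field]_2 mx_rat mx_rat_zmod.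
HB.instance Definition _ :=
  GRing.isMonoidMorphism.Build rat 'M[conic_field]_2 mx_rat mx_rat_monoid.

Definition mx_eval (u : free_alg) : 'M[conic_field]_2 :=
  monalg.mmap mx_rat mx_word u.

Lemma mx_evalD u v : mx_eval (u + v) = mx_eval u + mx_eval v.
Proof. exact: monalg.mmapD. Qed.

Lemma mx_evalM u v : mx_eval (u * v) = mx_eval u * mx_eval v.
Proof.
have h (g : {malg rat[{fmonom bool}]}) m m' :
    GRing.comm (mx_rat (monalg.mcoeff m g)) (mx_word m').
  exact/esym/comm_mx_scalar.
have [H _] := commr_mmap_is_multiplicative h; exact: H.
Qed.

Lemma mx_eval1 : mx_eval 1 = 1.
Proof. exact: monalg.mmap1. Qed.

Lemma mx_evalZ c u : mx_eval (c *: u) = mx_rat c * mx_eval u.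
Proof. exact: monalg.mmapZ. Qed.

Lemma mx_eval0 : mx_eval 0 = 0.
Proof. exact: monalg.mmap0. Qed.

Lemma mx_evalB u v : mx_eval (u - v) = mx_eval u - mx_eval v.
Proof. exact: monalg.mmapB. Qed.

Lemma mx_eval_x : mx_eval free_x = mx_x.
Proof.
have -> : mx_eval free_x = mx_rat 1 * mx_word (fmu true) by apply: monalg.mmapU.
rewrite (rmorph1 mx_rat) mul1r /mx_word fmuE; exact: big_seq1.
Qed.

Lemma mx_eval_y : mx_eval free_y = mx_y.
Proof.
have -> : mx_eval free_y = mx_rat 1 * mx_word (fmu false) by apply: monalg.mmapU.
rewrite (rmorph1 mx_rat) mul1r /mx_word fmuE; exact: big_seq1.
Qed.

Lemma mx_eval_ideal u : two_sided_ideal quaternion_relation u -> mx_eval u = 0.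
Proof.
elim=> [_ [] ->||{}u v _ IHu _ IHv|a {}u b _ IHu].
- by rewrite mx_evalD expr2 mx_evalM mx_eval1 mx_eval_x -expr2 (mx22_xx conic_eq).
- by rewrite mx_evalD expr2 mx_evalM mx_eval1 mx_eval_y -expr2 (mx22_yy conic_eq).
- have exy : mx_eval (free_x * free_y) = mx_x * mx_y.
    exact: etrans (mx_evalM _ _) (congr2 *%R mx_eval_x mx_eval_y).
  have eyx : mx_eval (free_y * free_x) = mx_y * mx_x.
    exact: etrans (mx_evalM _ _) (congr2 *%R mx_eval_y mx_eval_x).
  exact: etrans (mx_evalD _ _) (etrans (congr2 +%R exy eyx) (mx22_xy _ _)).
- exact: mx_eval0.
- by rewrite mx_evalD IHu IHv addr0.
- by rewrite !mx_evalM IHu mulr0 mul0r.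
Qed.

Definition mx_quat (q : quaternion) : 'M[conic_field]_2 := mx_eval (repr q).

Lemma mx_quat_cl u : mx_quat (quot_cl quaternion_relation u) = mx_eval u.
Proof.
apply/eqP; rewrite -subr_eq0 -mx_evalB; apply/eqP/mx_eval_ideal.
exact: quot_repr.
Qed.

Lemma mx_quatD p q : mx_quat (p + q) = mx_quat p + mx_quat q.
Proof. by rewrite [LHS]mx_quat_cl mx_evalD. Qed.

Lemma mx_quatM p q : mx_quat (p * q) = mx_quat p * mx_quat q.
Proof. by rewrite [LHS]mx_quat_cl mx_evalM. Qed.

Lemma mx_quat1 : mx_quat 1 = 1.
Proof. by rewrite [LHS]mx_quat_cl mx_eval1. Qed.

Lemma mx_quatZ c q : mx_quat (c *: q) = mx_rat c * mx_quat q.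
Proof. by rewrite [LHS]mx_quat_cl mx_evalZ. Qed.

Fact quaternion_nz : 1 != 0 :> quaternion.
Proof.
apply/eqP => h; have := mx_quat1; rewrite h => /eqP.
have -> : mx_quat 0 = 0 by rewrite [LHS]mx_quat_cl mx_eval0.
by rewrite eq_sym oner_eq0.
Qed.

HB.instance Definition _ := GRing.PzSemiRing_isNonZero.Build quaternion quaternion_nz.
HB.instance Definition _ :=
  GRing.Lmodule_isLalgebra.Build rat quaternion (@quot_scaleAl _ _ _).
HB.instance Definition _ :=
  GRing.Lalgebra_isAlgebra.Build rat quaternion (@quot_scaleAr _ _ _).

Definition quat_x : quaternion := quot_cl quaternion_relation free_x.
Definition quat_y : quaternion := quot_cl quaternion_relation free_y.

Definition mx_rep (t : ext_algebra conic_rat quaternion) : 'M[conic_field]_2 :=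
  tensor_lift (fun e (q : quaternion) => e *: mx_quat q) t.

Lemma mx_rep_bal :
  balanced conic_rat (fun e (q : quaternion) => e *: mx_quat q).
Proof.
split=> [e e' q|e q q'|e c q].
- by rewrite scalerDl.
- by rewrite mx_quatD scalerDr.
- rewrite mx_quatZ -scalerA; congr (_ *: _).
  exact/esym/mul_scalar_mx.
Qed.

Lemma mx_rep_tens e q : mx_rep (exta conic_rat e q) = e *: mx_quat q.
Proof. exact/tensor_lift_tens/mx_rep_bal. Qed.

Lemma mx_repD s t : mx_rep (s + t) = mx_rep s + mx_rep t.
Proof. exact/tensor_liftD/mx_rep_bal. Qed.

Lemma mx_rep0 : mx_rep 0 = 0.
Proof. exact/tensor_lift0/mx_rep_bal. Qed.

Lemma mx_rep1 : mx_rep 1 = 1.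
Proof. by rewrite [LHS]mx_rep_tens mx_quat1 scale1r. Qed.

Lemma mx_repM s t : mx_rep (s * t) = mx_rep s * mx_rep t.
Proof.
elim/tensor_ind: s => [e q||s s' IHs IHs']; last 2 first.
- by rewrite mul0r mx_rep0 mul0r.
- by rewrite mulrDl !mx_repD IHs IHs' mulrDl.
elim/tensor_ind: t => [e' q'||t t' IHt IHt']; last 2 first.
- by rewrite mulr0 mx_rep0 mulr0.
- by rewrite mulrDr !mx_repD IHt IHt' mulrDr.
rewrite -/(exta conic_rat e q) -/(exta conic_rat e' q') extaM !mx_rep_tens.
by rewrite mx_quatM -scalerAl -scalerAr scalerA.
Qed.

(* M: column vectors of length 2, on which 1 (x) x and 1 (x) y act by mx_x    *)
(* and mx_y (see quaternion_module_x and quaternion_module_y).                *)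
Definition quaternion_module : Type := 'cV[conic_field]_2.
HB.instance Definition _ := GRing.Zmodule.on quaternion_module.

Definition quaternion_act (t : ext_algebra conic_rat quaternion)
  (v : quaternion_module) : quaternion_module := mx_rep t *m v.

Fact quaternion_actA s t v :
  quaternion_act s (quaternion_act t v) = quaternion_act (s * t) v.
Proof. by rewrite /quaternion_act mx_repM -mulmxA. Qed.
Fact quaternion_act1 : left_id 1 quaternion_act.
Proof. by move=> v; rewrite /quaternion_act mx_rep1 mul1mx. Qed.
Fact quaternion_actDr : right_distributive quaternion_act +%R.
Proof. by move=> t u v; apply: mulmxDr. Qed.
Fact quaternion_actDl v : {morph quaternion_act^~ v : s t / s + t}.
Proof. by move=> s t; rewrite /quaternion_act mx_repD mulmxDl. Qed.

HB.instance Definition _ :=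
  GRing.Zmodule_isLmodule.Build (ext_algebra conic_rat quaternion)
    quaternion_module
    quaternion_actA quaternion_act1 quaternion_actDr quaternion_actDl.

Lemma quaternion_module_scalar (e : conic_field) (v : quaternion_module) :
  ext_scalar conic_rat quaternion e *: v = e *: (v : 'cV[conic_field]_2).
Proof.
rewrite -[LHS]/(mx_rep (exta conic_rat e 1) *m v) mx_rep_tens mx_quat1.
by rewrite -scalemxAl mul1mx.
Qed.

Lemma quaternion_module_x (v : quaternion_module) :
  exta conic_rat 1 quat_x *: v = mx_x *m v.
Proof.
rewrite -[LHS]/(mx_rep _ *m v) mx_rep_tens scale1r; congr (_ *m _).
by rewrite mx_quat_cl mx_eval_x.
Qed.

Lemma quaternion_module_y (v : quaternion_module) :
  exta conic_rat 1 quat_y *: v = mx_y *m v.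
Proof.
rewrite -[LHS]/(mx_rep _ *m v) mx_rep_tens scale1r; congr (_ *m _).
by rewrite mx_quat_cl mx_eval_y.
Qed.

(* Main.v *)
From HB Require Import structures.
From mathcomp Require Import mpoly.
Require Import Defs.
From mathcomp Require Import all_boot all_order all_algebra.
From mathcomp Require Import boolp ring lra zify.
From mathcomp Require Import generic_quotient fraction qpoly finmap monalg.

Set Implicit Arguments.
Unset Strict Implicit.
Unset Printing Implicit Defensive.

Import Order.TTheory GRing.Theory Num.Theory.
Local Open Scope ring_scope.

(** Whether M descends to an intermediate field L is a question about the ternary
    form c0^2 + c1^2 + c2^2 over L.

    If L contains al and be with al^2 + be^2 = -1, the matrices of x and y with
    (a, b) replaced by (al, be) have entries in L, and an explicit matrix over E
    conjugates them to the given ones; so M descends to L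
    ([point_field_of_definition]). Conversely, let M be the base change of M0. A
    basis of M0 over L stays independent over E, hence has at most two elements,
    and for a nonzero v in M0 the vectors v, x v and y v are dependent over L.
    The reduced norm of such a relation is a nontrivial zero of the form in L
    ([field_of_definition_isotropic]).

    Small fields L are excluded by the absolute value of E at infinity, for
    which |a| = |b| > 1 and whose residue field is Q(i). If it is at most 1 on
    all of L, then L is contained in Q ([subfield_bounded_rat]): an element t of
    L with residue p + q i gives w = (t - p)^2 + q^2 in L with |w| < 1; then
    w = 0, as 1/w is in L too; and t = p, because -1 is not a square in E. Over
    Q the form has no nontrivial zero, so a bounded L is not a field of
    definition ([bounded_not_field_of_definition]).

    (a) M is defined over E, in which any two elements are algebraically
    dependent, by counting dimensions ([conic_alg_dependent]). A field of
    transcendence degree 0 consists of algebraic elements, hence is bounded.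

    (b) A minimal field of definition L would lie in Q(al, be) for every point
    (al, be) of the conic over E. Cubing a + i b repeatedly yields points with
    |al| = |be| = q for arbitrarily large q ([unbounded_conic_points]), and on
    Q(al, be) the absolute value takes only the value 0 and powers of q
    ([point_subfield_gap]). So L would be bounded. *)

(** * The absolute value at infinity on Q[X], and the norm form *)

Definition poly_abs (p : {poly rat}) : rat :=
  if p == 0 then 0 else 2 ^+ (size p).-1.

Lemma poly_abs_ge0 p : 0 <= poly_abs p.
Proof. by rewrite /poly_abs; case: eqP => //= _; rewrite exprn_ge0. Qed.

Lemma poly_abs_eq0 p : (poly_abs p == 0) = (p == 0).
Proof.
by rewrite /poly_abs; case: (p =P 0) => [|_]; rewrite ?eqxx ?expf_eq0 ?andbF.
Qed.

Lemma poly_absC c : c != 0 -> poly_abs c%:P = 1.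
Proof. by move=> c0; rewrite /poly_abs polyC_eq0 (negPf c0) size_polyC c0. Qed.

Lemma poly_absN p : poly_abs (- p) = poly_abs p.
Proof. by rewrite /poly_abs oppr_eq0 size_polyN. Qed.

Lemma poly_absM p q : poly_abs (p * q) = poly_abs p * poly_abs q.
Proof.
rewrite /poly_abs mulf_eq0.
case: (p =P 0) => [_|/eqP p0]; first by rewrite mul0r.
case: (q =P 0) => [_|/eqP q0]; first by rewrite mulr0.
rewrite /= size_mul // -exprD (polySpred p0) (polySpred q0).
by rewrite addSn addnS.
Qed.

Lemma poly_abs_sqr p : poly_abs (p ^+ 2) = poly_abs p ^+ 2.
Proof. by rewrite !expr2 poly_absM. Qed.

Lemma ler_poly_abs p q : (poly_abs p <= poly_abs q) = (size p <= size q)%N.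
Proof.
have [->|p0] := eqVneq p 0.
  by rewrite size_poly0 leq0n /poly_abs eqxx poly_abs_ge0.
have [->|q0] := eqVneq q 0.
  rewrite size_poly0 leqn0 size_poly_eq0 (negPf p0) /poly_abs eqxx (negPf p0).
  by apply/negbTE; rewrite -ltNge exprn_gt0.
rewrite /poly_abs (negPf p0) (negPf q0) ler_eXn2l //.
by rewrite (polySpred p0) (polySpred q0).
Qed.

Lemma poly_absD p q : poly_abs (p + q) <= Num.max (poly_abs p) (poly_abs q).
Proof.
by rewrite le_max !ler_poly_abs -leq_max size_polyD.
Qed.

(** Leading coefficients of the same sign cannot cancel. *)
Lemma ler_poly_absDr (p q : {poly rat}) :
  0 <= lead_coef p -> 0 <= lead_coef q -> poly_abs p <= poly_abs (p + q).
Proof.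
rewrite ler_poly_abs => p0 q0.
have [lt_qp|lt_pq|eq_pq] := ltngtP (size q) (size p).
- by rewrite size_polyDl.
- by rewrite addrC size_polyDl // ltnW.
have [->|nzp] := eqVneq p 0; first by rewrite size_poly0.
rewrite (polySpred nzp) ltnNge; apply/negP => /leq_sizeP/(_ _ (leqnn _))/eqP.
rewrite coefD -[p`_ _]/(lead_coef p) -eq_pq -[q`_ _]/(lead_coef q).
by rewrite paddr_eq0 // lead_coef_eq0 (negPf nzp).
Qed.

(** The norm of [x0 + x1 b] from Q(a,b) to Q(a), with ['X] standing for [a]. *)
Definition norm_form (x : {poly rat} * {poly rat}) : {poly rat} :=
  x.1 ^+ 2 + ('X^2 + 1) * x.2 ^+ 2.

Lemma poly_abs_X21 : poly_abs ('X^2 + 1) = 4.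
Proof.
by rewrite /poly_abs -size_poly_eq0 -polyC1 size_XnaddC.
Qed.

Lemma lead_coef_sqr_ge0 (p : {poly rat}) : 0 <= lead_coef (p ^+ 2).
Proof. by rewrite expr2 lead_coefM -expr2 sqr_ge0. Qed.

Lemma lead_coef_X21_sqr_ge0 (p : {poly rat}) :
  0 <= lead_coef (('X^2 + 1) * p ^+ 2).
Proof.
by rewrite lead_coefM -polyC1 lead_coefXnaddC // mul1r lead_coef_sqr_ge0.
Qed.

Lemma poly_abs_norm_ge1 x : poly_abs x.1 ^+ 2 <= poly_abs (norm_form x).
Proof.
rewrite -poly_abs_sqr; apply: ler_poly_absDr.
  exact: lead_coef_sqr_ge0.
exact: lead_coef_X21_sqr_ge0.
Qed.

Lemma poly_abs_norm_ge2 x : 4 * poly_abs x.2 ^+ 2 <= poly_abs (norm_form x).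
Proof.
rewrite -poly_abs_X21 -poly_abs_sqr -poly_absM /norm_form [x.1 ^+ 2 + _]addrC.
apply: ler_poly_absDr; first exact: lead_coef_X21_sqr_ge0.
exact: lead_coef_sqr_ge0.
Qed.

Lemma poly_abs_norm_le x (r : rat) :
  poly_abs x.1 ^+ 2 <= r -> 4 * poly_abs x.2 ^+ 2 <= r ->
  poly_abs (norm_form x) <= r.
Proof.
rewrite -poly_abs_X21 -!poly_abs_sqr -poly_absM => h1 h2.
by apply: le_trans (poly_absD _ _) _; rewrite ge_max h1.
Qed.

Lemma norm_form_eq0 x : norm_form x = 0 -> x = 0.
Proof.
move=> N0; have h0 : poly_abs (norm_form x) = 0.
  by apply/eqP; rewrite poly_abs_eq0 N0.
have h1 := poly_abs_norm_ge1 x; have h2 := poly_abs_norm_ge2 x.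
rewrite h0 in h1 h2.
have s1 := sqr_ge0 (poly_abs x.1); have s2 := sqr_ge0 (poly_abs x.2).
have /eqP : poly_abs x.1 ^+ 2 = 0 by lra.
have /eqP : poly_abs x.2 ^+ 2 = 0 by lra.
rewrite !sqrf_eq0 !poly_abs_eq0 => /eqP e2 /eqP e1.
by case: x e1 e2 {N0 h0 h1 h2 s1 s2} => x1 x2 /= -> ->.
Qed.

Lemma poly_abs_norm_sum x y :
  poly_abs (norm_form (x + y))
    <= Num.max (poly_abs (norm_form x)) (poly_abs (norm_form y)).
Proof.
have hD (p q : {poly rat}) :
    poly_abs (p + q) ^+ 2 <= Num.max (poly_abs p ^+ 2) (poly_abs q ^+ 2).
  have := poly_absD p q; rewrite !le_max => /orP[] h; apply/orP; [left|right];
  by rewrite ler_sqr ?nnegrE ?poly_abs_ge0.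
apply: poly_abs_norm_le.
  apply: le_trans (hD _ _) _; rewrite ge_max !le_max.
  by rewrite !poly_abs_norm_ge1 orbT.
rewrite mulrC -ler_pdivlMr //; apply: le_trans (hD _ _) _.
rewrite ge_max !ler_pdivlMr // ![_ * 4]mulrC !le_max.
by rewrite !poly_abs_norm_ge2 orbT.
Qed.

Lemma poly_absD_lt p q r :
  poly_abs p < r -> poly_abs q < r -> poly_abs (p + q) < r.
Proof. by move=> hp hq; apply: le_lt_trans (poly_absD _ _) _; rewrite gt_max hp. Qed.

Lemma poly_absCM c p : poly_abs (c%:P * p) <= poly_abs p.
Proof. by rewrite ler_poly_abs mul_polyC size_scale_leq. Qed.

Lemma poly_abs_cancel (p d : {poly rat}) : d != 0 -> poly_abs p <= poly_abs d ->
  exists c, poly_abs (p - c%:P * d) < poly_abs d.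
Proof.
rewrite ler_poly_abs => d0 le_pd; exists (p`_(size d).-1 / lead_coef d).
rewrite ltNge ler_poly_abs -ltnNge {2}(polySpred d0) ltnS.
apply/leq_sizeP => j; rewrite leq_eqVlt => /orP[/eqP <-|lt_dj].
  by rewrite coefB coefCM -/(lead_coef d) divfK ?subrr // lead_coef_eq0.
have le_dj : (size d <= j)%N by rewrite (polySpred d0).
have le_pj := leq_trans le_pd le_dj.
by rewrite coefB coefCM (nth_default _ le_pj) (nth_default _ le_dj) mulr0 subrr.
Qed.

Lemma poly_abs_norm_size x c n : poly_abs (norm_form x) <= (2 ^+ c) ^+ (2 * n) ->
  (size x.1 <= c * n + 1)%N /\ (size x.2 <= c * n + 1)%N.
Proof.
have bnd (p : {poly rat}) :
    poly_abs p ^+ 2 <= (2 ^+ c) ^+ (2 * n) -> (size p <= c * n + 1)%N.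
  have -> : (2 ^+ c) ^+ (2 * n) = (2 ^+ (c * n)) ^+ 2 :> rat.
    by rewrite -!exprM; congr (_ ^+ _); lia.
  rewrite ler_sqr ?nnegrE ?poly_abs_ge0 ?exprn_ge0 //.
  rewrite /poly_abs; case: eqP => [->|_]; first by rewrite size_poly0.
  by rewrite ler_eXn2l // addn1; case: (size p).
move=> le_N; split; apply: bnd; apply: le_trans le_N.
  exact: poly_abs_norm_ge1.
apply: le_trans (poly_abs_norm_ge2 x).
by have := sqr_ge0 (poly_abs x.2); lra.
Qed.

(** Descent along the Pell unit [X - sqrt(X^2 + 1)] of norm -1. *)
Lemma X21_nonsquare (r y : {poly rat}) : ('X^2 + 1) * y ^+ 2 = r ^+ 2 -> y = 0.
Proof.
have [n] := ubnP (size y); elim: n => // n IHn in r y *; rewrite ltnS => le_yn e.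
apply/eqP; apply/negPn/negP => y0.
have y_gt0 : 0 < poly_abs y by rewrite lt0r poly_abs_eq0 y0 poly_abs_ge0.
have absr : poly_abs r = 2 * poly_abs y.
  apply/eqP; rewrite -(@eqrXn2 _ 2) ?mulr_ge0 ?poly_abs_ge0 // -poly_abs_sqr -e.
  by rewrite poly_absM poly_abs_X21 poly_abs_sqr exprMn.
(* r + y X and r - y X add up to 2 r, so one of them is as large as r. *)
wlog ge_r : r e absr / 2 * poly_abs y <= poly_abs (r + y * 'X).
  move=> hwlog.
  have [] := leP (2 * poly_abs y) (poly_abs (r + y * 'X)); first exact: hwlog.
  move=> lt1; have [] := leP (2 * poly_abs y) (poly_abs (- r + y * 'X)).
    by apply: hwlog; rewrite ?poly_absN ?sqrrN.
  rewrite -poly_absN opprD opprK => lt2; have := poly_absD_lt lt1 lt2.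
  have -> : r + y * 'X + (r - y * 'X) = 2%:P * r by rewrite polyC_natr; ring.
  by rewrite poly_absM poly_absC // mul1r absr ltxx.
have prod : poly_abs (r - y * 'X) * poly_abs (r + y * 'X) = poly_abs y ^+ 2.
  by rewrite -poly_absM -poly_abs_sqr; congr poly_abs; rewrite -subr_sqr -e; ring.
have lt_y' : poly_abs (r - y * 'X) < poly_abs y.
  have := poly_abs_ge0 (r - y * 'X); move: prod ge_r y_gt0; nra.
have y'0 : r - y * 'X = 0.
  apply: (IHn (r * 'X - y * ('X^2 + 1))).
    by apply: leq_trans le_yn; rewrite ltnNge -ler_poly_abs -ltNge.
  apply/eqP; rewrite -subr_eq0; apply/eqP.
  suff -> : ('X^2 + 1) * (r - y * 'X) ^+ 2 - (r * 'X - y * ('X^2 + 1)) ^+ 2 =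
     r ^+ 2 - ('X^2 + 1) * y ^+ 2 by rewrite e subrr.
  ring.
move/eqP: prod; rewrite y'0 {1}/poly_abs eqxx mul0r eq_sym sqrf_eq0 poly_abs_eq0.
by rewrite (negPf y0).
Qed.

(** * Evaluation at a point of the conic *)

(** Multiplication of [x0 + x1 b] and [y0 + y1 b], where [b^2 = -(a^2 + 1)]. *)
Definition conic_mul (x y : {poly rat} * {poly rat}) :=
  (x.1 * y.1 - ('X^2 + 1) * x.2 * y.2, x.1 * y.2 + x.2 * y.1).

Lemma norm_formM x y :
  norm_form (conic_mul x y) = norm_form x * norm_form y.
Proof. by rewrite /norm_form /=; ring. Qed.

Section ConicPoint.
Variables (E : fieldType) (iota : {rmorphism rat -> E}) (al be : E).

Definition pev (p : {poly rat}) : E := (map_poly iota p).[al].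

Fact pev_zmod : zmod_morphism pev.
Proof. by move=> p q; rewrite /pev rmorphB hornerD hornerN. Qed.
Fact pev_monoid : monoid_morphism pev.
Proof.
by split=> [|p q]; rewrite /pev ?rmorph1 ?hornerC // rmorphM hornerM.
Qed.
HB.instance Definition _ :=
  GRing.isZmodMorphism.Build {poly rat} E pev pev_zmod.
HB.instance Definition _ :=
  GRing.isMonoidMorphism.Build {poly rat} E pev pev_monoid.

Lemma pevX : pev 'X = al.
Proof. by rewrite /pev map_polyX hornerX. Qed.
Lemma pevC c : pev c%:P = iota c.
Proof. by rewrite /pev map_polyC hornerC. Qed.

Definition conic_eval (x : {poly rat} * {poly rat}) : E :=
  pev x.1 + pev x.2 * be.

Lemma conic_evalB x y : conic_eval (x - y) = conic_eval x - conic_eval y.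
Proof. by rewrite /conic_eval !rmorphB /=; ring. Qed.

Lemma conic_evalD x y : conic_eval (x + y) = conic_eval x + conic_eval y.
Proof. by rewrite /conic_eval !rmorphD /=; ring. Qed.

Hypothesis al_be : al ^+ 2 + be ^+ 2 = -1.

Lemma conic_evalM x y :
  conic_eval (conic_mul x y) = conic_eval x * conic_eval y.
Proof.
rewrite /conic_eval /conic_mul /= rmorphB !rmorphM rmorphD /= !rmorphM /=.
rewrite !rmorphD !rmorphM !rmorph1 /= pevX.
have -> : al * al + 1 = - be ^+ 2.
  by apply/eqP; rewrite -subr_eq0 opprK addrAC -expr2 al_be addNr.
ring.
Qed.
End ConicPoint.
Arguments conic_evalM [E iota al be] al_be x y.

(** * The absolute value at infinity of the function field *)

(** A function field of the conic a^2 + b^2 + 1 = 0: every element has the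
    form [(x0(a) + x1(a) b) / d(a)], and [x0] and [x1] are determined by
    [x0(a) + x1(a) b]. *)
Definition conic_function_field (E : fieldType) (iota : {rmorphism rat -> E})
    (a b : E) : Prop :=
  [/\ a ^+ 2 + b ^+ 2 = -1,
      forall x, conic_eval iota a b x = 0 -> x = 0
    & forall e, exists xd : ({poly rat} * {poly rat}) * {poly rat},
        xd.2 != 0 /\ e = conic_eval iota a b xd.1 / pev iota a xd.2].

Section AbsoluteValue.
Variables (E : fieldType) (iota : {rmorphism rat -> E}) (a b : E).
Hypothesis conicE : conic_function_field iota a b.
Local Notation cev := (conic_eval iota a b).
Local Notation aev := (pev iota a).

Let conic_eq : a ^+ 2 + b ^+ 2 = -1. Proof. by case: conicE. Qed.
Let conic_eval_eq0 x : cev x = 0 -> x = 0. Proof. by case: conicE => _ h _; apply: h. Qed.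
Let conic_fracP e : exists xd : ({poly rat} * {poly rat}) * {poly rat},
  xd.2 != 0 /\ e = cev xd.1 / aev xd.2.
Proof. by case: conicE => _ _; apply. Qed.

Lemma pev_a_eq0 p : (aev p == 0) = (p == 0).
Proof.
apply/eqP/eqP => [p0|->]; last exact: rmorph0.
have : cev (p, 0) = 0 by rewrite /conic_eval /= p0 rmorph0 mul0r addr0.
by move/conic_eval_eq0 => [].
Qed.

(** Up to normalization, the absolute value at infinity composed with the norm
    to Q(a): it is the square of the one that takes the value 2 at [a]. *)
Definition conic_abs (e : E) : rat :=
  let xd := projT1 (cid (conic_fracP e)) in
  poly_abs (norm_form xd.1) / poly_abs xd.2 ^+ 2.

Lemma norm_form_scale d x : norm_form (conic_mul (d, 0) x) = d ^+ 2 * norm_form x.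
Proof. by rewrite norm_formM {1}/norm_form /=; ring. Qed.

Lemma conic_eval_scale d x : cev (conic_mul (d, 0) x) = aev d * cev x.
Proof.
by rewrite (conic_evalM conic_eq) {1}/conic_eval /= rmorph0 mul0r addr0.
Qed.

Lemma conic_absE x d : d != 0 ->
  conic_abs (cev x / aev d) = poly_abs (norm_form x) / poly_abs d ^+ 2.
Proof.
move=> d0; rewrite /conic_abs; case: cid => [[y c]] /= [c0 eyc].
have e : conic_mul (d, 0) y = conic_mul (c, 0) x.
  apply/eqP; rewrite -subr_eq0; apply/eqP/conic_eval_eq0.
  rewrite conic_evalB !conic_eval_scale; apply/eqP; rewrite subr_eq0.
  by move/eqP: eyc; rewrite eqr_div ?pev_a_eq0 // mulrC => /eqP ->; rewrite mulrC.
have := congr1 (poly_abs \o norm_form) e; rewrite /= !norm_form_scale.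
rewrite ![poly_abs (_ * norm_form _)]poly_absM !poly_abs_sqr => h; apply/eqP.
rewrite eqr_div ?sqrf_eq0 ?poly_abs_eq0 // mulrC h mulrC //.
Qed.

Lemma conic_abs_eval x : conic_abs (cev x) = poly_abs (norm_form x).
Proof.
have := @conic_absE x 1 (oner_neq0 _).
by rewrite rmorph1 divr1 -polyC1 poly_absC ?oner_neq0 // expr1n divr1.
Qed.

Lemma conic_absM e f : conic_abs (e * f) = conic_abs e * conic_abs f.
Proof.
have [[x c] [/= c0 ->]] := conic_fracP e; have [[y d] [/= d0 ->]] := conic_fracP f.
rewrite mulf_div -(conic_evalM conic_eq) -rmorphM !conic_absE ?mulf_neq0 //.
by rewrite norm_formM !poly_absM exprMn mulf_div.
Qed.

Lemma conic_abs_ge0 e : 0 <= conic_abs e.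
Proof. by rewrite divr_ge0 ?exprn_ge0 ?poly_abs_ge0. Qed.

Lemma conic_abs_eq0 e : (conic_abs e == 0) = (e == 0).
Proof.
have [[x c] [/= c0 ->]] := conic_fracP e; rewrite conic_absE // !mulf_eq0.
rewrite !invr_eq0 sqrf_eq0 !poly_abs_eq0 pev_a_eq0 (negPf c0) !orbF.
by apply/eqP/eqP => [/norm_form_eq0 ->|/conic_eval_eq0 ->];
  rewrite /conic_eval /norm_form /= ?rmorph0 ?expr0n /= ?mulr0 ?mul0r addr0.
Qed.

Lemma conic_abs0 : conic_abs 0 = 0.
Proof. by apply/eqP; rewrite conic_abs_eq0. Qed.

(** The absolute value is ultrametric because at infinity the two terms of
    the norm form never cancel: both have positive leading coefficients. *)
Lemma conic_absD e f : conic_abs (e + f) <= Num.max (conic_abs e) (conic_abs f).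
Proof.
have [[x c] [/= c0 ->]] := conic_fracP e; have [[y d] [/= d0 ->]] := conic_fracP f.
have cd0 : c * d != 0 by rewrite mulf_neq0.
have -> : cev x / aev c = cev (conic_mul (d, 0) x) / aev (c * d).
  by rewrite conic_eval_scale rmorphM /= [aev d * _]mulrC -mulf_div divff ?mulr1 ?pev_a_eq0.
have -> : cev y / aev d = cev (conic_mul (c, 0) y) / aev (c * d).
  by rewrite conic_eval_scale rmorphM /= -mulf_div divff ?mul1r ?pev_a_eq0.
rewrite -mulrDl -conic_evalD !conic_absE // le_max.
have cd2 : 0 < poly_abs (c * d) ^+ 2.
  by rewrite lt0r sqrf_eq0 poly_abs_eq0 cd0 sqr_ge0.
by rewrite !ler_pM2r ?invr_gt0 // -le_max poly_abs_norm_sum.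
Qed.

Lemma conic_abs_pev p : conic_abs (aev p) = poly_abs p ^+ 2.
Proof.
have -> : aev p = cev (p, 0) by rewrite /conic_eval /= rmorph0 mul0r addr0.
by rewrite conic_abs_eval /norm_form /= expr0n /= mulr0 addr0 poly_abs_sqr.
Qed.

Lemma conic_abs_rat c : c != 0 -> conic_abs (iota c) = 1.
Proof. by move=> c0; rewrite -(pevC iota a) conic_abs_pev poly_absC ?expr1n. Qed.

Lemma conic_abs1 : conic_abs 1 = 1.
Proof. by rewrite -(rmorph1 iota) conic_abs_rat ?oner_neq0. Qed.

Lemma conic_absV e : conic_abs e^-1 = (conic_abs e)^-1.
Proof.
have [->|e0] := eqVneq e 0; first by rewrite invr0 conic_abs0 invr0.
apply: (mulIf (x := conic_abs e)); first by rewrite conic_abs_eq0.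
by rewrite -conic_absM !mulVf ?conic_abs_eq0 ?conic_abs1.
Qed.

Lemma conic_absX e n : conic_abs (e ^+ n) = conic_abs e ^+ n.
Proof.
elim: n => [|n IHn]; first by rewrite !expr0 conic_abs1.
by rewrite !exprS conic_absM IHn.
Qed.

Lemma conic_absN e : conic_abs (- e) = conic_abs e.
Proof.
rewrite -mulN1r conic_absM -(rmorph1 iota) -rmorphN conic_abs_rat ?mul1r //.
Qed.

Lemma conic_abs_a : conic_abs a = 4.
Proof. by rewrite -(pevX iota a) conic_abs_pev /poly_abs polyX_eq0 size_polyX. Qed.

Lemma conic_abs_b : conic_abs b = 4.
Proof.
have -> : b = cev (0, 1) by rewrite /conic_eval /= rmorph0 rmorph1 mul1r add0r.
by rewrite conic_abs_eval /norm_form /= expr0n add0r expr1n mulr1 poly_abs_X21.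
Qed.

(** * Algebraic elements and bounded subfields *)

Lemma conic_abs_dominant e f :
  conic_abs f < conic_abs e -> conic_abs (e + f) = conic_abs e.
Proof.
move=> lt_fe; apply/le_anti/andP; split.
  by apply: le_trans (conic_absD _ _) _; rewrite ge_max lexx ltW.
have := conic_absD (e + f) (- f); rewrite addrK conic_absN le_max => /orP[] //.
by rewrite leNgt lt_fe.
Qed.

(** The leading term dominates. *)
Lemma conic_abs_pev_large t p : 1 < conic_abs t -> p != 0 ->
  conic_abs (pev iota t p) = conic_abs t ^+ (size p).-1.
Proof.
move=> t1; elim/poly_ind: p => [|p c IHp] pc0; first by rewrite eqxx in pc0.
rewrite rmorphD rmorphM /= pevX pevC size_MXaddC.
have [p0|p0] /= := eqVneq p 0.
  have c0 : c != 0 by move: pc0; rewrite p0 mul0r add0r polyC_eq0.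
  by rewrite p0 rmorph0 mul0r add0r (negPf c0) size_poly0 conic_abs_rat.
have lt1 : 1 < conic_abs (pev iota t p * t).
  rewrite conic_absM IHp // -exprSr; exact: exprn_egt1.
rewrite conic_abs_dominant.
  by rewrite conic_absM IHp // -exprSr (polySpred p0).
have [->|c0] := eqVneq c 0; first by rewrite rmorph0 conic_abs0 (lt_trans ltr01).
by rewrite conic_abs_rat.
Qed.

(** Algebraic elements have no pole at infinity. *)
Lemma conic_abs_algebraic t p :
  p != 0 -> pev iota t p = 0 -> conic_abs t <= 1.
Proof.
move=> p0 tp0; rewrite leNgt; apply/negP => t1.
have := conic_abs_pev_large t1 p0; rewrite tp0 conic_abs0 => /esym/eqP.
by rewrite expf_eq0 andbC gt_eqF // (lt_trans ltr01).
Qed.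

(** The residue field at infinity is Q(i), as [(b/a)^2 = -1 - 1/a^2]; the
    witnesses [p] and [q] are the two coordinates of the residue of [e]. *)
Lemma conic_residue e : conic_abs e <= 1 ->
  exists p q, conic_abs ((e - iota p) ^+ 2 + iota q ^+ 2) < 1.
Proof.
have [[[x1 x2] d] [/= d0 ->]] := conic_fracP e.
have d_gt0 : 0 < poly_abs d by rewrite lt0r poly_abs_eq0 d0 poly_abs_ge0.
rewrite conic_absE // ler_pdivrMr ?exprn_gt0 // mul1r => le_Nd.
have le1 : poly_abs x1 <= poly_abs d.
  rewrite -ler_sqr ?nnegrE ?poly_abs_ge0 //; apply: le_trans le_Nd.
  exact: (poly_abs_norm_ge1 (x1, x2)).
have absX : poly_abs 'X = 2 by rewrite /poly_abs polyX_eq0 size_polyX.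
have le2 : poly_abs ('X * x2) <= poly_abs d.
  rewrite -ler_sqr ?nnegrE ?poly_abs_ge0 //; apply: le_trans le_Nd.
  rewrite poly_absM absX exprMn.
  by have := poly_abs_norm_ge2 (x1, x2).
(* residues of x1 / d and of a x2 / d, where b is close to i a *)
have [p lt1] := poly_abs_cancel d0 le1; have [q lt2] := poly_abs_cancel d0 le2.
exists p, q; set u := x1 - _ in lt1; set v := 'X * x2 - _ in lt2.
have -> : (cev (x1, x2) / aev d - iota p) ^+ 2 + iota q ^+ 2 =
    cev (u ^+ 2 - (v * ('X * x2 + q%:P * d) + x2 ^+ 2), u * x2 + u * x2) / aev (d ^+ 2).
  have -> : u ^+ 2 - (v * ('X * x2 + q%:P * d) + x2 ^+ 2) =
      u * u - ('X^2 + 1) * x2 * x2 + (q%:P * d) ^+ 2 by rewrite /v; ring.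
  have -> : (u * u - ('X^2 + 1) * x2 * x2 + (q%:P * d) ^+ 2, u * x2 + u * x2) =
      conic_mul (u, x2) (u, x2) + ((q%:P * d) ^+ 2, 0).
    by rewrite /conic_mul /=; congr pair; rewrite /= ?addr0 ?[x2 * u]mulrC.
  rewrite conic_evalD (conic_evalM conic_eq) -expr2.
  have -> : cev ((q%:P * d) ^+ 2, 0) = (iota q * aev d) ^+ 2.
    by rewrite /conic_eval /= rmorph0 mul0r addr0 rmorphXn rmorphM /= pevC.
  have -> : cev (u, x2) = cev (x1, x2) - iota p * aev d.
    by rewrite /conic_eval /= rmorphB rmorphM /= pevC; ring.
  have dE0 : aev d != 0 by rewrite pev_a_eq0.
  by rewrite rmorphXn /=; field.
rewrite conic_absE ?sqrf_eq0 // ltr_pdivrMr ?exprn_gt0 //; last first.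
  by rewrite poly_abs_sqr exprn_gt0.
rewrite mul1r.
have hlt (y z : {poly rat}) : poly_abs y < poly_abs d -> poly_abs z <= poly_abs d ->
    poly_abs (y * z) < poly_abs (d ^+ 2).
  move=> hy hz; rewrite expr2 !poly_absM; apply: le_lt_trans (_ : poly_abs y * poly_abs d < _).
    by rewrite ler_wpM2l ?poly_abs_ge0.
  by rewrite ltr_pM2r.
have lt_x2 : poly_abs x2 < poly_abs d.
  have := poly_abs_ge0 x2; move: le2; rewrite poly_absM absX; lra.
have lt_z1 : poly_abs (u ^+ 2 - (v * ('X * x2 + q%:P * d) + x2 ^+ 2)) < poly_abs (d ^+ 2).
  apply: poly_absD_lt; first by rewrite expr2 hlt // ltW.
  rewrite poly_absN; apply: poly_absD_lt; last by rewrite expr2 hlt // ltW.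
  apply: hlt => //; apply: le_trans (poly_absD _ _) _.
  by rewrite ge_max le2 poly_absCM.
have lt_z2 : 2 * poly_abs (u * x2 + u * x2) < poly_abs (d ^+ 2).
  apply: le_lt_trans (_ : poly_abs (u * ('X * x2)) < _); last exact: hlt.
  rewrite !poly_absM absX mulrCA ler_pM2l //.
  by apply: le_trans (poly_absD _ _) _; rewrite ge_max poly_absM lexx.
apply: le_lt_trans (_ : Num.max (poly_abs (u ^+ 2 - (v * ('X * x2 + q%:P * d) + x2 ^+ 2)) ^+ 2)
  (4 * poly_abs (u * x2 + u * x2) ^+ 2) < _).
  by apply: poly_abs_norm_le; rewrite /= le_max lexx ?orbT.
have -> : 4 * poly_abs (u * x2 + u * x2) ^+ 2 = (2 * poly_abs (u * x2 + u * x2)) ^+ 2 by ring.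
by rewrite gt_max !ltr_sqr ?nnegrE ?mulr_ge0 ?poly_abs_ge0 // lt_z1.
Qed.

Lemma conic_sqr_sum_eq0 e q : e ^+ 2 + iota q ^+ 2 = 0 -> e = 0.
Proof.
have [[[x1 x2] d] [/= d0 ->]] := conic_fracP e => h.
have dE0 : aev d != 0 by rewrite pev_a_eq0.
have : conic_mul (x1, x2) (x1, x2) + ((q%:P * d) ^+ 2, 0) = 0.
  apply: conic_eval_eq0; rewrite conic_evalD (conic_evalM conic_eq) -expr2.
  have -> : cev ((q%:P * d) ^+ 2, 0) = (iota q * aev d) ^+ 2.
    by rewrite /conic_eval /= rmorph0 mul0r addr0 rmorphXn rmorphM /= pevC.
  apply: (mulIf (x := (aev d ^+ 2)^-1)); first by rewrite invr_eq0 sqrf_eq0.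
  by rewrite mul0r -h; field.
rewrite /conic_mul /= => -[/eqP h1 /eqP h2].
move: h2; rewrite addr0 [x2 * x1]mulrC -mulr2n -mulr_natl -polyC_natr.
rewrite mulf_eq0 polyC_eq0 pnatr_eq0 mulf_eq0 /=.
case/orP => /eqP x0; rewrite x0 ?(mul0r, mulr0, sub0r, subr0) in h1 *.
  have x20 : x2 = 0.
    apply: (@X21_nonsquare (q%:P * d)); apply/esym/eqP.
    by rewrite -subr_eq0 addrC [x2 ^+ 2]expr2 mulrA.
  by rewrite x20 /conic_eval !rmorph0 mul0r addr0 mul0r.
have /eqP : poly_abs x1 ^+ 2 = 0.
  apply/le_anti; rewrite sqr_ge0 andbT -poly_abs_sqr.
  rewrite -[leRHS](_ : poly_abs (x1 ^+ 2 + (q%:P * d) ^+ 2) = 0).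
    by apply: ler_poly_absDr; apply: lead_coef_sqr_ge0.
  by rewrite [x1 ^+ 2]expr2 (eqP h1); apply/eqP; rewrite poly_abs_eq0.
rewrite sqrf_eq0 poly_abs_eq0 => /eqP ->.
by rewrite /conic_eval !rmorph0 mul0r addr0 mul0r.
Qed.

(** On a field where the absolute value is trivial, an element [t] with residue
    [p + q i] satisfies [(t - p)^2 + q^2 = 0], as a nonzero left-hand side has
    absolute value less than 1; and E contains no square root of -1. *)
Lemma subfield_bounded_rat (L : intermediate_field iota) :
  (forall t, t \in L -> conic_abs t <= 1) ->
  forall t, t \in L -> exists c, t = iota c.
Proof.
move=> bndL t Lt; have [p [q lt1]] := conic_residue (bndL t Lt).
exists p; apply/eqP; rewrite -subr_eq0; apply/eqP/(@conic_sqr_sum_eq0 _ q).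
apply/eqP/negPn/negP => w0.
have Lw : (t - iota p) ^+ 2 + iota q ^+ 2 \in L.
  by rewrite rpredD ?rpredX ?rpredB ?(intermediate_base L).
have /bndL : ((t - iota p) ^+ 2 + iota q ^+ 2)^-1 \in L by rewrite rpredV.
rewrite conic_absV invf_le1; first by rewrite leNgt lt1.
by rewrite lt0r conic_abs_eq0 w0 conic_abs_ge0.
Qed.

End AbsoluteValue.

(** * Subfields generated by a point of the conic *)

Section GeneratedSubfield.
Variables (E : fieldType) (iota : {rmorphism rat -> E}) (al be : E).
Hypothesis al_be : al ^+ 2 + be ^+ 2 = -1.
Local Notation ev := (conic_eval iota al be).

(** The field Q(al, be). A vanishing denominator only contributes the
    element 0. *)
Definition point_field (e : E) : bool :=
  `[< exists x y, e = ev x / ev y >].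

Lemma conic_eval0 : ev 0 = 0.
Proof. by rewrite /conic_eval !rmorph0 mul0r addr0. Qed.

Lemma conic_eval_const c : ev (c%:P, 0) = iota c.
Proof. by rewrite /conic_eval /= pevC rmorph0 mul0r addr0. Qed.

Lemma conic_eval1 : ev (1, 0) = 1.
Proof. by rewrite -polyC1 conic_eval_const rmorph1. Qed.

Lemma point_field_eval x : point_field (ev x).
Proof. by apply/asboolP; exists x, (1, 0); rewrite conic_eval1 divr1. Qed.

Lemma point_field_rat c : iota c \in point_field.
Proof. by rewrite -conic_eval_const; apply: point_field_eval. Qed.

Fact point_field_closed : divring_closed point_field.
Proof.
split=> [|_ _ /asboolP[x [y ->]] /asboolP[z [w ->]]
         |_ _ /asboolP[x [y ->]] /asboolP[z [w ->]]]; apply/asboolP.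
- by exists (1, 0), (1, 0); rewrite conic_eval1 divr1.
- have [y0|y0] := eqVneq (ev y) 0.
    exists (0 - z), w; rewrite conic_evalB conic_eval0 y0 invr0 mulr0.
    by rewrite !sub0r mulNr.
  have [w0|w0] := eqVneq (ev w) 0.
    by exists x, y; rewrite w0 invr0 mulr0 subr0.
  exists (conic_mul x w - conic_mul z y), (conic_mul y w).
  by rewrite conic_evalB !(conic_evalM al_be); field; rewrite ?y0 ?w0.
- by exists (conic_mul x w), (conic_mul y z); rewrite !(conic_evalM al_be) invf_div mulf_div.
Qed.

Definition point_subfield : intermediate_field iota :=
  @IntermediateField _ _ iota
    (HB.pack_for (GRing.DivringClosed.type E) point_field
      (GRing.isDivringClosed.Build E point_field point_field_closed))
    point_field_rat.

Lemma point_subfield_al : al \in point_subfield.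
Proof.
have -> : al = ev ('X, 0) by rewrite /conic_eval /= pevX rmorph0 mul0r addr0.
exact: point_field_eval.
Qed.

Lemma point_subfield_be : be \in point_subfield.
Proof.
have -> : be = ev (0, 1) by rewrite /conic_eval /= rmorph0 rmorph1 mul1r add0r.
exact: point_field_eval.
Qed.

End GeneratedSubfield.

Section PointFields.
Variables (E : fieldType) (iota : {rmorphism rat -> E}) (a b : E).
Hypothesis conicE : conic_function_field iota a b.
Local Notation nu := (conic_abs conicE).

(** Both [x1 + x2 be] and its conjugate [x1 - x2 be] are bounded by the same
    power of [q], whose square is the value of their product; so both bounds
    are attained. *)
Lemma conic_abs_point al be (q : rat) x :
    al ^+ 2 + be ^+ 2 = -1 -> 1 < q -> nu al = q -> nu be = q -> x != 0 ->
  exists n, nu (conic_eval iota al be x) = q ^+ n.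
Proof.
move=> al_be q1 al_q be_q x0; pose n := maxn (size x.1).-1 (size x.2).
exists n; pose x' := (x.1, - x.2).
have q0 : 0 < q by apply: lt_trans q1.
have bnd p : nu (pev iota al p) <= q ^+ (size p).-1.
  have [->|p0] := eqVneq p 0; first by rewrite rmorph0 conic_abs0 exprn_ge0 // ltW.
  by rewrite -al_q conic_abs_pev_large // al_q.
have bnd2 p : nu (pev iota al p * be) <= q ^+ (size p).
  have [->|p0] := eqVneq p 0.
    by rewrite rmorph0 mul0r conic_abs0 exprn_ge0 // ltW.
  by rewrite conic_absM be_q (polySpred p0) exprSr ler_pM2r.
have bndx : nu (conic_eval iota al be x) <= q ^+ n.
  apply: le_trans (conic_absD _ _ _) _; rewrite ge_max.
  rewrite (le_trans (bnd _)) ?(le_trans (bnd2 _)) //.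
    by rewrite ler_eXn2l // leq_maxr.
  by rewrite ler_eXn2l // leq_maxl.
have bndx' : nu (conic_eval iota al be x') <= q ^+ n.
  apply: le_trans (conic_absD _ _ _) _; rewrite ge_max.
  rewrite (le_trans (bnd _)) ?(le_trans (bnd2 _)) //= ?size_polyN.
    by rewrite ler_eXn2l // leq_maxr.
  by rewrite ler_eXn2l // leq_maxl.
have N0 : norm_form x != 0 by apply: contraNneq x0 => /norm_form_eq0 ->.
have prod : nu (conic_eval iota al be x) * nu (conic_eval iota al be x') =
    q ^+ (size (norm_form x)).-1.
  rewrite -conic_absM -(conic_evalM al_be) /conic_mul /conic_eval /=.
  have -> : x.1 * - x.2 + x.2 * x.1 = 0 by ring.
  have -> : x.1 * x.1 - ('X^2 + 1) * x.2 * - x.2 = norm_form x.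
    by rewrite /norm_form; ring.
  by rewrite rmorph0 mul0r addr0 conic_abs_pev_large ?al_q.
have le_n : (2 * n <= (size (norm_form x)).-1)%N.
  rewrite -(@ler_eXn2l rat 2) // mulnC exprM.
  have normE : poly_abs (norm_form x) = 2 ^+ (size (norm_form x)).-1.
    by rewrite /poly_abs (negPf N0).
  rewrite -normE /n; case: leqP => [_|lt_x].
    have [x20|x20] := eqVneq x.2 0.
      rewrite x20 size_poly0 expr0 expr1n normE exprn_ege1 //.
    have := poly_abs_norm_ge2 x; rewrite {1}/poly_abs (negPf x20).
    have h4 : 2 ^+ 2 = 4 :> rat by [].
    by rewrite (polySpred x20) [2 ^+ (_.+1)]exprS exprMn h4.
  have := poly_abs_norm_ge1 x; rewrite {1}/poly_abs ifN //.
  by apply: contraTneq lt_x => ->; rewrite size_poly0.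
apply/le_anti; rewrite bndx /=.
have : q ^+ n * q ^+ n <= q ^+ n * nu (conic_eval iota al be x).
  rewrite -exprD addnn -mul2n; apply: le_trans (_ : q ^+ (size (norm_form x)).-1 <= _).
    by rewrite ler_eXn2l.
  by rewrite -prod mulrC ler_wpM2r ?conic_abs_ge0.
by rewrite ler_pM2l ?exprn_gt0.
Qed.

(** The values on Q(al, be) are 0 and the integer powers of [q]. *)
Lemma point_subfield_gap al be (q : rat) e :
    al ^+ 2 + be ^+ 2 = -1 -> 1 < q -> nu al = q -> nu be = q ->
    point_field iota al be e -> 1 < nu e -> q <= nu e.
Proof.
move=> al_be q1 al_q be_q /asboolP[x [y ->]].
have q0 : 0 < q by apply: lt_trans q1.
have [->|x0] := eqVneq x 0.
  by rewrite conic_eval0 mul0r conic_abs0 ltNge ler01.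
have [->|y0] := eqVneq y 0.
  by rewrite conic_eval0 invr0 mulr0 conic_abs0 ltNge ler01.
have [n en] := conic_abs_point al_be q1 al_q be_q x0.
have [m em] := conic_abs_point al_be q1 al_q be_q y0.
rewrite conic_absM conic_absV en em ltr_pdivlMr ?ler_pdivlMr ?exprn_gt0 // mul1r.
by rewrite ltr_eXn2l // -exprS ler_eXn2l.
Qed.

(** In terms of [z = a + i b], with [z * conj z = -1], the step below is
    [z |-> z^3]; cubing keeps the product -1 and multiplies pole orders by 3. *)
Lemma unbounded_conic_points n : exists al be q,
  [/\ al ^+ 2 + be ^+ 2 = -1, nu al = q, nu be = q & n.+2%:R <= q].
Proof.
elim: n => [|n [al [be [q [al_be al_q be_q lt_nq]]]]].
  exists a, b, 4; rewrite conic_abs_a conic_abs_b; split=> //.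
  by case: conicE.
have q2 : 2 <= q by apply: le_trans lt_nq; rewrite ler_nat.
have q1 : 1 < q by lra.
have cube t : nu t = q -> nu (t * (t ^+ 2 * iota 4 + iota 3)) = q ^+ 3.
  move=> tq; rewrite conic_absM tq conic_abs_dominant !conic_absM tq.
    by rewrite conic_abs_rat //; ring.
  by rewrite !conic_abs_rat //; nra.
exists (al * (al ^+ 2 * iota 4 + iota 3)), (- (be * (be ^+ 2 * iota 4 + iota 3))), (q ^+ 3).
split; rewrite ?conic_absN ?cube //.
  rewrite !rmorph_nat; have -> : be ^+ 2 = -1 - al ^+ 2 by rewrite -al_be addrC addKr.
  rewrite sqrrN exprMn [(be * _) ^+ 2]exprMn.
  have -> : be ^+ 2 = -1 - al ^+ 2 by rewrite -al_be addrC addKr.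
  ring.
have q3 : q * 4 <= q ^+ 3.
  by rewrite exprS ler_pM2l ?(lt_trans ltr01) //; nra.
by rewrite -natr1; lra.
Qed.

(** An element of every field Q(al, be) has no pole, as otherwise its value
    would exceed arbitrarily large gaps. *)
Lemma all_point_fields_bounded e :
  (forall al be, al ^+ 2 + be ^+ 2 = -1 -> point_field iota al be e) ->
  nu e <= 1.
Proof.
move=> inf; rewrite leNgt; apply/negP => e1.
have [al [be [q [al_be al_q be_q lt_nq]]]] := unbounded_conic_points (Num.bound (nu e)).
have q1 : 1 < q by apply: lt_le_trans lt_nq; rewrite ltr1n.
have := point_subfield_gap al_be q1 al_q be_q (inf _ _ al_be) e1.
rewrite leNgt => /negP[]; apply: lt_le_trans lt_nq.
apply: lt_trans (archi_boundP (conic_abs_ge0 _ _)) _.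
by rewrite ltr_nat.
Qed.

End PointFields.

(** * Algebraic dependence *)

Lemma tall_mx_row_relation (F : fieldType) (m n : nat) (A : 'M[F]_(m, n)) :
  (n < m)%N -> exists2 v : 'rV_m, (exists i, v 0 i != 0) & v *m A = 0.
Proof.
move=> lt_nm; have : ~~ row_free A.
  by rewrite /row_free neq_ltn (leq_ltn_trans (rank_leq_col A)).
rewrite -kermx_eq0 => /rowV0Pn[v /sub_kermxP vA v0].
by exists v => //; apply/rV0Pn.
Qed.

Section AlgebraicDependence.
Variables (E : fieldType) (iota : {rmorphism rat -> E}) (a b : E).
Hypothesis conicE : conic_function_field iota a b.
Local Notation nu := (conic_abs conicE).
Local Notation cev := (conic_eval iota a b).
Local Notation aev := (pev iota a).

Lemma conic_eval_pow x n : exists y, cev y = cev x ^+ n.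
Proof.
have ab : a ^+ 2 + b ^+ 2 = -1 by case: conicE.
elim: n => [|n [y ey]]; first by exists (1, 0); rewrite conic_eval1.
by exists (conic_mul x y); rewrite (conic_evalM ab) ey exprS.
Qed.

(** The [K^2] monomials [f^i g^j] with [i, j < K], cleared of denominators,
    lie in a space of dimension linear in [K]. *)
Lemma conic_alg_dependent (f g : E) : exists K (c : 'I_K * 'I_K -> rat),
  (exists ij, c ij != 0) /\
  \sum_ij iota (c ij) * (f ^+ ij.1 * g ^+ ij.2) = 0.
Proof.
have [ab eval_eq0 fracP] := conicE.
have [[u d] [/= d0 ef]] := fracP f; have [[w d'] [/= d'0 eg]] := fracP g.
pose D := (d * d', 0 : {poly rat}).
have eD : cev D = aev d * aev d'.
  by rewrite /conic_eval /= rmorph0 mul0r addr0 rmorphM.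
have aD0 : aev d * aev d' != 0 by rewrite -rmorphM (pev_a_eq0 conicE) mulf_neq0.
have [dE0 d'E0] : aev d != 0 /\ aev d' != 0.
  by rewrite !(pev_a_eq0 conicE).
have [F eF] : exists F, cev F = f * cev D.
  exists (conic_mul (d', 0) u); rewrite (conic_eval_scale conicE) eD ef.
  by field.
have [G eG] : exists G, cev G = g * cev D.
  exists (conic_mul (d, 0) w); rewrite (conic_eval_scale conicE) eD eg.
  by field.
have [c [hF hG hD]] : exists c, [/\ nu (cev F) <= 2 ^+ c,
    nu (cev G) <= 2 ^+ c & nu (cev D) <= 2 ^+ c].
  exists (maxn (size (norm_form F)) (maxn (size (norm_form G)) (size (norm_form D)))).
  rewrite !conic_abs_eval.
  have bnd (p : {poly rat}) n : (size p <= n)%N -> poly_abs p <= 2 ^+ n.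
    rewrite /poly_abs; case: eqP => [_ _|_ le_n]; first by rewrite exprn_ge0.
    by rewrite ler_eXn2l // (leq_trans (leq_pred _)).
  by split; apply: bnd; rewrite ?leq_max ?leqnn ?orbT.
(* k is such that (k + 1)^2 > 2 (c k + 1); both exponents range over 0..k *)
pose k := (2 * c + 1)%N; pose N := (c * k + 1)%N.
have monom (ij : 'I_k.+1 * 'I_k.+1) : exists y,
    [/\ cev y = cev D ^+ (2 * k) * (f ^+ ij.1 * g ^+ ij.2),
        (size y.1 <= N)%N & (size y.2 <= N)%N].
  case: ij => i j /=; have [le_i le_j] := (ltn_ord i, ltn_ord j).
  have [y1 e1] := conic_eval_pow F i; have [y2 e2] := conic_eval_pow G j.
  have [y3 e3] := conic_eval_pow D (2 * k - (i + j)).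
  have ey : cev (conic_mul (conic_mul y1 y2) y3) =
      cev F ^+ i * cev G ^+ j * cev D ^+ (2 * k - (i + j)).
    by rewrite !(conic_evalM ab) e1 e2 e3.
  have split_2k : (2 * k = i + j + (2 * k - (i + j)))%N by rewrite subnKC //; lia.
  exists (conic_mul (conic_mul y1 y2) y3).
  have le_N : poly_abs (norm_form (conic_mul (conic_mul y1 y2) y3)) <=
      (2 ^+ c) ^+ (2 * k).
    rewrite -(conic_abs_eval conicE) ey !conic_absM !conic_absX.
    rewrite [in leRHS]split_2k !exprD.
    rewrite !ler_pM ?mulr_ge0 ?exprn_ge0 ?conic_abs_ge0 // lerXn2r //;
    by rewrite nnegrE ?exprn_ge0 ?conic_abs_ge0.
  have [le1 le2] := poly_abs_norm_size le_N; split=> //.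
  rewrite ey eF eG [in RHS]split_2k !exprD !exprMn; ring.
have [Y hY] := fin_all_exists monom.
pose T := ('I_k.+1 * 'I_k.+1)%type.
pose A : 'M[rat]_(#|{: T}|, N + N) :=
  \matrix_r row_mx (poly_rV (Y (enum_val r)).1) (poly_rV (Y (enum_val r)).2).
have [|v [r0 vr0] vA] := tall_mx_row_relation A.
  rewrite card_prod card_ord /N /k; nia.
exists k.+1, (fun ij => v 0 (enum_rank ij)); split.
  by exists (enum_val r0); rewrite enum_valK.
have col_eq0 (y : T -> {poly rat}) :
    (forall ij, size (y ij) <= N)%N ->
    (forall l : 'I_N, \sum_r v 0 r * (y (enum_val r))`_l = 0) ->
    \sum_ij (v 0 (enum_rank ij))%:P * y ij = 0.
  move=> sz_y sum0; apply/polyP => l; rewrite coef_sum coef0.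
  have [lt_l|ge_l] := ltnP l N; last first.
    by apply: big1 => ij _; rewrite coefCM nth_default ?mulr0 // (leq_trans (sz_y _)).
  rewrite -[RHS](sum0 (Ordinal lt_l)) (reindex (@enum_val T predT)) /=.
    by apply: eq_bigr => r _; rewrite coefCM enum_valK.
  exact/onW_bij/enum_val_bij.
have e1 : \sum_ij (v 0 (enum_rank ij))%:P * (Y ij).1 = 0.
  apply: (col_eq0 (fun ij => (Y ij).1)) => [ij|l]; first by case: (hY ij).
  have := congr1 (fun M : 'rV[rat]_(N + N) => M 0 (lshift N l)) vA; rewrite !mxE => h; apply: etrans h.
  by apply: eq_bigr => r _; rewrite mxE row_mxEl mxE.
have e2 : \sum_ij (v 0 (enum_rank ij))%:P * (Y ij).2 = 0.
  apply: (col_eq0 (fun ij => (Y ij).2)) => [ij|l]; first by case: (hY ij).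
  have := congr1 (fun M : 'rV[rat]_(N + N) => M 0 (rshift N l)) vA; rewrite !mxE => h; apply: etrans h.
  by apply: eq_bigr => r _; rewrite mxE row_mxEr mxE.
apply: (mulfI (x := cev D ^+ (2 * k))); first by rewrite expf_neq0 // eD.
have sum0 : cev (\sum_ij (v 0 (enum_rank ij))%:P * (Y ij).1,
    \sum_ij (v 0 (enum_rank ij))%:P * (Y ij).2) = 0.
  by rewrite e1 e2 conic_eval0.
rewrite mulr0 mulr_sumr; apply: etrans sum0.
rewrite {2}/conic_eval /= !rmorph_sum /= mulr_suml -big_split.
apply: eq_bigr => ij _ /=.
have [ey _ _] := hY ij.
by rewrite mulrCA -ey !rmorphM /= !pevC -mulrA -mulrDr.
Qed.
End AlgebraicDependence.

(** * The fraction field of Q[a,b]/(a^2 + b^2 + 1) *)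

Lemma fraction_num_den (R : idomainType) (e : {fraction R}) :
  exists u v : R, v != 0 /\ e = tofrac u / tofrac v.
Proof.
elim/quotW: e => r; exists \n_r, \d_r; have d0 := denom_ratioP r.
split=> //; apply: (canRL (mulfK _)); first by rewrite tofrac_eq0.
unlock tofrac; rewrite -[LHS]FracField.pi_mul; apply/eqmodP => /=.
rewrite FracField.equivfE /FracField.mulf !numden_Ratio ?(mulf_neq0, oner_eq0) //.
by rewrite mulr1 mulr1 mulrC.
Qed.

Lemma conic_in_polyC p : conic_in p%:P = pev conic_rat conic_a p.
Proof.
elim/poly_ind: p => [|p c IHp]; first by rewrite !rmorph0.
by rewrite polyCD polyCM !rmorphD !rmorphM /= IHp pevC pevX.
Qed.

Lemma conic_in_eval x :
  conic_in (x.1%:P + x.2%:P * 'X) = conic_eval conic_rat conic_a conic_b x.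
Proof. by rewrite rmorphD rmorphM /= !conic_in_polyC. Qed.

Lemma conic_field_eval_eq0 x :
  conic_eval conic_rat conic_a conic_b x = 0 -> x = 0.
Proof.
rewrite -conic_in_eval => /eqP.
rewrite /conic_in tofrac_eq0 => /eqP x0.
have : x.1%:P + x.2%:P * 'X = 0.
  rewrite -[LHS](@in_qpoly_small _ conic_poly) ?(congr1 val x0) //.
  rewrite mk_monic_conic size_conic_poly ltnS; apply: leq_trans (size_polyD _ _) _.
  rewrite geq_max (leq_trans (size_polyC_leq1 _)) //= mul_polyC.
  by rewrite (leq_trans (size_scale_leq _ _)) ?size_polyX.
move=> /polyP h; have := h 1; have := h 0.
rewrite !coefD !coefC !coefCM !coefX /= mulr0 mulr1 addr0 add0r.
by case: x {h x0} => x1 x2 /= -> ->.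
Qed.

Lemma conic_ring_eval (u : conic_ring) :
  exists x, tofrac u = conic_eval conic_rat conic_a conic_b x.
Proof.
exists ((conic_lift u)`_0, (conic_lift u)`_1).
rewrite -conic_in_eval /= mul_polyC -conic_ring_repr /conic_in.
congr tofrac; apply: val_inj; rewrite /= /conic_lift.
exact: esym (in_qpoly_small (size_mk_monic (u : {poly %/ conic_poly}))).
Qed.

Section RationalizedFraction.
Variables (E : fieldType) (iota : {rmorphism rat -> E}) (a b : E).
Hypothesis conic_eq : a ^+ 2 + b ^+ 2 = -1.
Local Notation cev := (conic_eval iota a b).
Hypothesis eval_eq0 : forall x, cev x = 0 -> x = 0.

(** Multiply by the conjugate of the denominator. *)
Lemma conic_frac_rationalize x y : cev y != 0 ->
  exists xd : ({poly rat} * {poly rat}) * {poly rat},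
    xd.2 != 0 /\ cev x / cev y = cev xd.1 / pev iota a xd.2.
Proof.
move=> y0; pose y' := (y.1, - y.2).
have yy' : cev y * cev y' = pev iota a (norm_form y).
  rewrite -(conic_evalM conic_eq) /conic_mul /conic_eval /= /norm_form.
  rewrite [X in pev _ _ X * _](_ : _ = 0); last by ring.
  by rewrite rmorph0 mul0r addr0; congr pev; ring.
have N0 : norm_form y != 0.
  by apply: contraNneq y0 => /norm_form_eq0 ->; rewrite conic_eval0.
have y'0 : cev y' != 0.
  apply: contraNneq N0 => y'0; apply/eqP.
  have /eval_eq0 [//] : cev (norm_form y, 0) = 0.
  by rewrite /conic_eval /= rmorph0 mul0r addr0 -yy' y'0 mulr0.
exists (conic_mul x y', norm_form y); split=> //=.
by rewrite (conic_evalM conic_eq) -yy' -mulf_div divff // mulr1.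
Qed.
End RationalizedFraction.

Lemma conic_fieldP : conic_function_field conic_rat conic_a conic_b.
Proof.
split; [exact: conic_eq | exact: conic_field_eval_eq0 |].
move=> e; have [u [v [v0 ->]]] := fraction_num_den e.
have [x ->] := conic_ring_eval u; have [y ey] := conic_ring_eval v.
rewrite ey; apply: (conic_frac_rationalize conic_eq conic_field_eval_eq0).
by rewrite -ey tofrac_eq0.
Qed.

(** * Bases and tensor products *)

Section FreeFamilies.
Variables (K : fieldType) (V : lmodType K).

Definition spans n (w : 'I_n -> V) : Prop :=
  forall v, exists c : 'I_n -> K, v = \sum_i c i *: w i.

Definition independent n (w : 'I_n -> V) : Prop :=
  forall c : 'I_n -> K, \sum_i c i *: w i = 0 -> forall i, c i = 0.

(** A spanning family of least size is independent: a vector that occurs in a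
    relation could be dropped. *)
Lemma exists_basis n (w : 'I_n -> V) : spans w ->
  exists m (u : 'I_m -> V), spans u /\ independent u.
Proof.
move=> span_w; pose P m := `[< exists u : 'I_m -> V, spans u >].
have exP : exists m, P m by exists n; apply/asboolP; exists w.
case: (ex_minnP exP) => m /asboolP[u span_u] min_m; exists m, u; split=> // c.
case: m u c min_m span_u => [|m] u c min_m span_u rel i; first by case: i.
apply: contrapT => /eqP ci0.
suff /min_m : P m by rewrite ltnn.
apply/asboolP; exists (fun j => u (lift i j)) => v.
have [d ->] := span_u v; exists (fun j => d (lift i j) - d i / c i * c (lift i j)).
have ui : u i = - (c i)^-1 *: \sum_j c (lift i j) *: u (lift i j).
  apply: (scalerI ci0); rewrite scalerA mulrN divff // scaleN1r; apply/eqP.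
  by rewrite -addr_eq0; move/eqP: rel; rewrite (bigD1_ord i).
rewrite (bigD1_ord i) //= {1}ui scalerA scaler_sumr -big_split /=.
by apply: eq_bigr => j _; rewrite scalerA -scalerDl addrC mulrN mulNr.
Qed.
End FreeFamilies.

Section TensorBasis.
Variables (K E : fieldType) (phi : {rmorphism K -> E}) (V : lmodType K).

Lemma tens0r (e : E) : tens phi e (0 : V) = 0.
Proof. by apply: (addrI (tens phi e 0)); rewrite -tensDr !addr0. Qed.

Lemma tens_sumr (e : E) n (m : 'I_n -> V) :
  tens phi e (\sum_i m i) = \sum_i tens phi e (m i).
Proof. by apply: (big_morph (tens phi e) (tensDr phi e) (tens0r e)). Qed.

(** The coordinates on [V] extend to the tensor product. *)
Lemma tensor_independent n (w : 'I_n -> V) (e : 'I_n -> E) :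
  spans w -> independent w ->
  \sum_i tens phi (e i) (w i) = 0 -> forall i, e i = 0.
Proof.
move=> span_w free_w rel i; have [c hc] := choice span_w.
have cE v d : v = \sum_j d j *: w j -> forall j, c v j = d j.
  move=> ev j; apply/eqP; rewrite -subr_eq0; apply/eqP.
  apply: (free_w (fun j => c v j - d j)).
  under eq_bigr => k _ do rewrite scalerBl.
  by rewrite sumrB -hc -ev subrr.
(* the E-linear extension of the i-th coordinate *)
have bal : balanced phi (fun s v => s * phi (c v i)).
  split=> [s s' v|s v v'|s r v]; first by rewrite mulrDl.
    rewrite (cE (v + v') (fun j => c v j + c v' j)) ?rmorphD ?mulrDr //.
    under eq_bigr => k _ do rewrite scalerDl.
    by rewrite big_split /= -!hc.
  rewrite (cE (r *: v) (fun j => r * c v j)) ?rmorphM ?mulrA //.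
  by rewrite {1}(hc v) scaler_sumr; apply: eq_bigr => k _; rewrite scalerA.
have lift_sum (I : Type) (s : seq I) (x : I -> E ⊗[phi] V) :
    tensor_lift (fun s v => s * phi (c v i)) (\sum_(k <- s) x k) =
    \sum_(k <- s) tensor_lift (fun s v => s * phi (c v i)) (x k).
  exact: (big_morph _ (tensor_liftD bal) (tensor_lift0 bal)).
have cw k : c (w k) i = (k == i)%:R.
  apply: (cE _ (fun j => (k == j)%:R)).
  rewrite (bigD1 k) //= eqxx scale1r big1 ?addr0 // => j.
  by rewrite eq_sym => /negPf ->; rewrite scale0r.
have := lift_sum _ (index_enum 'I_n) (fun k => tens phi (e k) (w k)).
rewrite rel tensor_lift0 // (bigD1 i) //= tensor_lift_tens // cw eqxx rmorph1 mulr1.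
rewrite big1 ?addr0 // => k ki.
by rewrite tensor_lift_tens // cw (negPf ki) rmorph0 mulr0.
Qed.
End TensorBasis.

(** * A spanning family of the quaternion algebra *)

(** A word is built from 1 by multiplying on the left by its letters. *)
Lemma free_alg_ind (P : free_alg -> Prop) :
    P 1 -> (forall u, P u -> P (free_x * u)) -> (forall u, P u -> P (free_y * u)) ->
    P 0 -> (forall u v, P u -> P v -> P (u + v)) ->
    (forall c u, P u -> P (c *: u)) ->
  forall u, P u.
Proof.
move=> P1 Px Py P0 PD PZ u; rewrite (monalgE u).
apply: big_ind => // -[w] _ {P0 PD}.
move: (mcoeff _ _) => c.
have -> : mkmalgU (FMonom w) c = c *: (mkmalgU (FMonom w) 1 : free_alg).
  apply/malgP => k; rewrite mcoeffZ !mcoeffU.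
  by case: eqP => _; rewrite ?mulr1n ?mulr1 ?mulr0n ?mulr0.
apply: PZ; elim: w => [|l w IHw]; first by rewrite -fmoneE.
have -> : mkmalgU (FMonom (l :: w)) 1 = (mkmalgU (fmu l) 1 : free_alg) * mkmalgU (FMonom w) 1.
  rewrite [RHS]malgM_def fgmulUU mulr1; congr mkmalgU.
  by rewrite fmuE [RHS]fmmulE.
by case: l; [apply: Px | apply: Py].
Qed.

Definition quat_cl (u : free_alg) : quaternion := quot_cl quaternion_relation u.

Lemma quat_clD u v : quat_cl (u + v) = quat_cl u + quat_cl v.
Proof. exact: quot_clD_ring. Qed.
Lemma quat_clM u v : quat_cl (u * v) = quat_cl u * quat_cl v.
Proof. exact: quot_clM_ring. Qed.
Lemma quat_clZ c u : quat_cl (c *: u) = c *: quat_cl u.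
Proof. exact: quot_clZ_ring. Qed.

Lemma quat_cl_eq0 u : quaternion_relation u -> quat_cl u = 0.
Proof. by move=> rel_u; apply/quot_clP; rewrite subr0; apply: IdealGen. Qed.

Lemma quat_xx : quat_x * quat_x = - 1.
Proof.
apply/eqP; rewrite -addr_eq0; apply/eqP.
rewrite -[LHS]/(quat_cl free_x * quat_cl free_x + quat_cl 1).
by rewrite -quat_clM -quat_clD -expr2; apply/quat_cl_eq0/Or31.
Qed.

Lemma quat_yy : quat_y * quat_y = - 1.
Proof.
apply/eqP; rewrite -addr_eq0; apply/eqP.
rewrite -[LHS]/(quat_cl free_y * quat_cl free_y + quat_cl 1).
by rewrite -quat_clM -quat_clD -expr2; apply/quat_cl_eq0/Or32.
Qed.

Lemma quat_yx : quat_y * quat_x = - (quat_x * quat_y).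
Proof.
apply/eqP; rewrite -addr_eq0 addrC; apply/eqP.
rewrite -[LHS]/(quat_cl free_x * quat_cl free_y + quat_cl free_y * quat_cl free_x).
by rewrite -!quat_clM -quat_clD; apply/quat_cl_eq0/Or33.
Qed.

Section QuaternionRelations.
Variables (R : comPzRingType) (A : algType R) (x y : A).
Hypotheses (xx : x * x = - 1) (yy : y * y = - 1) (yx : y * x = - (x * y)).

Definition quat_comb (c0 c1 c2 c3 : R) : A :=
  c0 *: 1 + c1 *: x + c2 *: y + c3 *: (x * y).

Lemma quat_comb_mulx c0 c1 c2 c3 :
  x * quat_comb c0 c1 c2 c3 = quat_comb (- c1) c0 (- c3) c2.
Proof.
rewrite /quat_comb !mulrDr -!scalerAr mulr1 mulrA xx mulN1r !scalerN !scaleNr.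
by rewrite (ACl (2*1*4*3)).
Qed.

Lemma quat_comb_muly c0 c1 c2 c3 :
  y * quat_comb c0 c1 c2 c3 = quat_comb (- c2) c3 c0 (- c1).
Proof.
rewrite /quat_comb !mulrDr -!scalerAr mulr1 yy mulrA yx mulNr -mulrA yy mulrN1.
by rewrite opprK !scalerN !scaleNr (ACl (3*4*1*2)).
Qed.

Lemma quat_combD c0 c1 c2 c3 d0 d1 d2 d3 :
  quat_comb c0 c1 c2 c3 + quat_comb d0 d1 d2 d3 =
  quat_comb (c0 + d0) (c1 + d1) (c2 + d2) (c3 + d3).
Proof.
by rewrite /quat_comb !scalerDl (AC (4*4) ((1*5)*(2*6)*(3*7)*(4*8))).
Qed.

Lemma quat_combZ d c0 c1 c2 c3 :
  d *: quat_comb c0 c1 c2 c3 = quat_comb (d * c0) (d * c1) (d * c2) (d * c3).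
Proof. by rewrite /quat_comb !scalerDr !scalerA. Qed.

Lemma quat_comb0 : quat_comb 0 0 0 0 = 0.
Proof. by rewrite /quat_comb !scale0r !addr0. Qed.

Lemma quat_comb1 : quat_comb 1 0 0 0 = 1.
Proof. by rewrite /quat_comb !scale0r scale1r !addr0. Qed.
Lemma quat_comb_sum c0 c1 c2 c3 :
  quat_comb c0 c1 c2 c3 =
  \sum_(i < 4) nth 0 [:: c0; c1; c2; c3] i *: nth 0 [:: 1; x; y; x * y] i.
Proof. by rewrite !big_ord_recl big_ord0 addr0 /quat_comb !addrA. Qed.
End QuaternionRelations.
Arguments quat_comb_mulx {R A x y}.
Arguments quat_comb_muly {R A x y}.

Lemma quaternion_span (q : quaternion) :
  exists c0 c1 c2 c3, q = quat_comb quat_x quat_y c0 c1 c2 c3.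
Proof.
have [u ->] : exists u, q = quat_cl u by apply: Defs.quotW.
elim/free_alg_ind: u.
- by exists 1, 0, 0, 0; rewrite quat_comb1.
- move=> u [c0 [c1 [c2 [c3 e]]]]; exists (- c1), c0, (- c3), c2.
  rewrite quat_clM e; exact: (quat_comb_mulx quat_xx).
- move=> u [c0 [c1 [c2 [c3 e]]]]; exists (- c2), c3, c0, (- c1).
  rewrite quat_clM e; exact: (quat_comb_muly quat_yy quat_yx).
- by exists 0, 0, 0, 0; rewrite quat_comb0.
- move=> u v [c0 [c1 [c2 [c3 e]]]] [d0 [d1 [d2 [d3 e']]]].
  exists (c0 + d0), (c1 + d1), (c2 + d2), (c3 + d3).
  rewrite quat_clD e e'; exact: quat_combD.
move=> c u [c0 [c1 [c2 [c3 e]]]]; exists (c * c0), (c * c1), (c * c2), (c * c3).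
by rewrite quat_clZ e; exact: quat_combZ.
Qed.

(** * Modules over an extended algebra *)

Section ExtensionOfScalars.
Variables (F K : comPzRingType) (j : {rmorphism F -> K}) (A : algType F).
Local Notation exta := (@exta F K j A).

Lemma extaDl k k' a : exta (k + k') a = exta k a + exta k' a.
Proof. exact: tensDl. Qed.
Lemma extaDr k a a' : exta k (a + a') = exta k a + exta k a'.
Proof. exact: tensDr. Qed.
Lemma exta_bal k r a : exta (k * j r) a = exta k (r *: a).
Proof. exact: tens_bal. Qed.
Lemma exta0l a : exta 0 a = 0.
Proof. by apply: (addrI (exta 0 a)); rewrite -extaDl !addr0. Qed.
Lemma exta0r k : exta k 0 = 0.
Proof. by apply: (addrI (exta k 0)); rewrite -extaDr !addr0. Qed.

Lemma ext_algebra_ind (P : ext_algebra j A -> Prop) :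
  (forall k a, P (exta k a)) -> P 0 -> (forall t u, P t -> P u -> P (t + u)) ->
  forall t, P t.
Proof. exact: tensor_ind. Qed.

Lemma ext_algebra_span n (b : 'I_n -> A) :
    (forall a, exists c : 'I_n -> F, a = \sum_i c i *: b i) ->
  forall t : ext_algebra j A, exists k : 'I_n -> K, t = \sum_i exta (k i) (b i).
Proof.
move=> span_b t; elim/ext_algebra_ind: t => [k a||t u [k ->] [l ->]].
- have [c ->] := span_b a; exists (fun i => k * j (c i)).
  rewrite (big_morph (exta k) (extaDr k) (exta0r k)).
  by apply: eq_bigr => i _; rewrite exta_bal.
- by exists (fun=> 0); rewrite big1 // => i _; rewrite exta0l.
exists (fun i => k i + l i); rewrite -big_split /=.
by apply: eq_bigr => i _; rewrite extaDl.
Qed.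
End ExtensionOfScalars.

Lemma spans_fin (K : fieldType) (V : lmodType K) (T : finType) (w : T -> V) :
  (forall v, exists c : T -> K, v = \sum_i c i *: w i) ->
  spans (fun i : 'I_#|T| => w (enum_val i)).
Proof.
move=> span_w v; have [c ->] := span_w v; exists (fun i => c (enum_val i)).
by rewrite (reindex (@enum_val T T)) //; apply/onW_bij/enum_val_bij.
Qed.

Section BasisOfModule.
Variables (K : fieldType) (F : comPzRingType) (j : {rmorphism F -> K}).
Variables (A : algType F) (M0 : lmodType (ext_algebra j A)).
Local Notation V := (restrict_scalars (ext_scalar j A) M0).

Lemma restrict_scaleE (k : K) (m : M0) : k *: (m : V) = exta j k 1 *: m.
Proof. by []. Qed.

Lemma finitely_generated_basis n (b : 'I_n -> A) :
    (forall a, exists c : 'I_n -> F, a = \sum_i c i *: b i) ->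
    finitely_generated M0 ->
  exists m (u : 'I_m -> V), spans u /\ independent u.
Proof.
move=> span_b [s gen_s].
pose w (p : 'I_(size s) * 'I_n) : V := exta j 1 (b p.2) *: s`_p.1.
apply: (@exists_basis _ _ _ (fun i => w (enum_val i))); apply: spans_fin => v.
have [c ->] := gen_s v.
have [k ek] := fin_all_exists (fun i => ext_algebra_span span_b (c i)).
exists (fun p => k p.1 p.2); rewrite -(pair_bigA _ (fun p q => k p q *: w (p, q))) /=.
apply: eq_bigr => i _; rewrite {1}ek scaler_suml; apply: eq_bigr => l _.
by rewrite restrict_scaleE scalerA extaM mulr1 mul1r.
Qed.
End BasisOfModule.

(** * A field of definition has an isotropic ternary form *)

Lemma anticommuting_norm (R : pzRingType) (s p q s2 p2 q2 : R) :
    s * p = p * s -> s * q = q * s -> q * p = - (p * q) ->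
    s * s = s2 -> p * p = - p2 -> q * q = - q2 ->
  (s - (p + q)) * (s + (p + q)) = s2 + p2 + q2.
Proof.
move=> sp sq qp ss pp qq.
have sz : s * (p + q) = (p + q) * s by rewrite mulrDr mulrDl sp sq.
have zz : (p + q) * (p + q) = - (p2 + q2).
  rewrite mulrDl !mulrDr pp qq qp (AC (2*2) ((1*4)*(2*3))) /= subrr addr0.
  by rewrite opprD.
by rewrite mulrDr !mulrBl sz zz opprK ss addrA addrNK addrA.
Qed.

Section QuaternionNorm.
Variables (F K : comPzRingType) (j : {rmorphism F -> K}) (A : algType F).
Variables (x y : A).
Hypotheses (xx : x * x = - 1) (yy : y * y = - 1) (yx : y * x = - (x * y)).
Local Notation exta := (@exta F K j A).

Lemma extaN k a : exta k (- a) = - exta k a.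
Proof. by apply/eqP; rewrite -addr_eq0 -extaDr addNr exta0r. Qed.

(** The reduced norm, on elements without an [x * y] term. *)
Lemma quaternion_norm (c0 c1 c2 : K) :
  (exta c0 1 - (exta c1 x + exta c2 y)) * (exta c0 1 + (exta c1 x + exta c2 y)) =
  exta (c0 ^+ 2 + c1 ^+ 2 + c2 ^+ 2) 1.
Proof.
rewrite !extaDl; apply: anticommuting_norm; rewrite !extaM.
- by rewrite mulr1 mul1r mulrC.
- by rewrite mulr1 mul1r mulrC.
- by rewrite yx extaN mulrC.
- by rewrite mulr1.
- by rewrite xx extaN.
- by rewrite yy extaN.
Qed.
End QuaternionNorm.

Section Descent.
Variables (F E : fieldType) (iota : {rmorphism F -> E}) (A : algType F).
Variables (L : intermediate_field iota).
Local Notation K := (subfield_of L).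
Local Notation jL := (@base_incl F E iota L).

Variable M0 : lmodType (ext_algebra jL A).
Local Notation V := (restrict_scalars (ext_scalar jL A) M0).

Lemma base_scale_scalar (e : E) (m : M0) :
  exta iota e 1 *: (base_tens 1 m : base_change M0) = base_tens e m.
Proof.
rewrite -[LHS]/(base_scale (exta iota e 1) (base_tens 1 m)).
rewrite base_scale_tens base_act_tens mulr1; congr base_tens.
exact: scale1r.
Qed.

Lemma base_tens_eq0 : (forall m : M0, m = 0) -> forall z : base_change M0, z = 0.
Proof.
move=> M00; elim/tensor_ind => [e m||z1 z2 -> ->] //; last exact: addr0.
rewrite (M00 m : m = 0); exact: (@tens0r _ _ (@subfield_incl _ _ _ L) V e).
Qed.

Variable M : lmodType (ext_algebra iota A).

(** The E-dimension of [M], in a form that only uses the action of the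
    extended algebra. *)
Definition dim_le d : Prop :=
  forall n (u : 'I_n -> M), (d < n)%N -> exists e : 'I_n -> E,
    (exists i, e i != 0) /\ \sum_i exta iota (e i) 1 *: u i = 0.

(** A basis of [M0] over L stays independent over E in [M]. *)
Lemma basis_size_le d m (u : 'I_m -> V) :
    spans u -> independent u -> dim_le d -> lmod_isomorphic M (base_change M0) ->
  (m <= d)%N.
Proof.
move=> span_u free_u dimM [f [g fK gK]]; rewrite leqNgt; apply/negP => lt_dm.
have [e [[i ei0] rel]] := dimM _ (fun i => g (base_tens 1 (u i))) lt_dm.
case/eqP: ei0; apply: (tensor_independent (phi := @subfield_incl _ _ _ L) span_u free_u).
transitivity (f (\sum_i exta iota (e i) 1 *: g (base_tens 1 (u i)))).
  rewrite linear_sum; apply: eq_bigr => k _.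
  by rewrite linearZ /= gK base_scale_scalar.
by rewrite rel linear0.
Qed.

Lemma three_dependent m (u : 'I_m -> V) (v : 'I_3 -> M0) :
    spans u -> (m < 3)%N -> exists c : 'I_3 -> K,
  (exists i, c i != 0) /\ \sum_i exta jL (c i) 1 *: v i = 0.
Proof.
move=> span_u lt_m3.
have [d hd] := fin_all_exists (fun i => span_u (v i : V)).
have [c c0 cd] := tall_mx_row_relation (\matrix_(i < 3, k < m) d i k) lt_m3.
exists (fun i => c 0 i); split=> //.
transitivity (\sum_i c 0 i *: (v i : V)); first exact: eq_bigr.
under eq_bigr => i _ do rewrite hd scaler_sumr.
rewrite exchange_big big1 //= => k _.
under eq_bigr => i _ do rewrite scalerA.
rewrite -scaler_suml; have := congr1 (fun M : 'rV[K]_m => M 0 k) cd.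
rewrite !mxE => h; rewrite -[RHS](scale0r (u k)); congr (_ *: _).
by apply: etrans h; apply: eq_bigr => i _; rewrite mxE.
Qed.

End Descent.

(** The quaternion algebra acts on an L-space of dimension at most 2, so for a nonzero
    vector [v] the vectors [v], [x v], [y v] are dependent; the reduced norm of
    the relation kills [v]. *)
Lemma field_of_definition_isotropic (F E : fieldType) (iota : {rmorphism F -> E})
    (A : algType F) (x y : A) n (b : 'I_n -> A) (M : lmodType (ext_algebra iota A))
    (L : intermediate_field iota) :
    x * x = - 1 -> y * y = - 1 -> y * x = - (x * y) ->
    (forall a, exists c : 'I_n -> F, a = \sum_i c i *: b i) ->
    dim_le M 2 -> (exists v : M, v != 0) -> field_of_definition M L ->
  exists c0 c1 c2, [/\ c0 \in L, c1 \in L & c2 \in L] /\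
    [/\ c0 ^+ 2 + c1 ^+ 2 + c2 ^+ 2 = 0 & ~ [/\ c0 = 0, c1 = 0 & c2 = 0]].
Proof.
move=> xx yy yx span_b dimM [v0 v0_neq0] [M0 [gen_M0 iso]].
have [m [u [span_u free_u]]] := finitely_generated_basis span_b gen_M0.
have le_m2 := basis_size_le span_u free_u dimM iso.
have [v v_neq0] : exists v : M0, v != 0.
  apply: contrapT => all0; have M00 (v : M0) : v = 0.
    by apply: contrapT => /eqP v_neq0; apply: all0; exists v.
  case: iso => f [g fK gK]; case/eqP: v0_neq0.
  apply: (can_inj fK); rewrite linear0; exact: base_tens_eq0.
pose w (i : 'I_3) := exta (@base_incl F E iota L) 1 (nth 1 [:: 1; x; y] i) *: v.
have [c [[i ci0] rel]] := three_dependent w span_u le_m2.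
pose c0 := c ord0; pose c1 := c (lift ord0 ord0); pose c2 := c (lift ord0 (lift ord0 ord0)).
have norm0 : c0 ^+ 2 + c1 ^+ 2 + c2 ^+ 2 = 0.
  apply/eqP/negPn/negP => N0; case/eqP: v_neq0.
  have rel' : (exta (@base_incl F E iota L) c0 1 + (exta (@base_incl F E iota L) c1 x +
      exta (@base_incl F E iota L) c2 y)) *: v = 0.
    rewrite -rel !big_ord_recl big_ord0 addr0 /w /= !scalerA !extaM !mulr1 !mul1r.
    by rewrite !scalerDl.
  have : exta (@base_incl F E iota L) (c0 ^+ 2 + c1 ^+ 2 + c2 ^+ 2) 1 *: v = 0.
    by rewrite -(quaternion_norm _ xx yy yx) -scalerA rel' scaler0.
  move/(congr1 ( *:%R (exta (@base_incl F E iota L) (c0 ^+ 2 + c1 ^+ 2 + c2 ^+ 2)^-1 1))).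
  by rewrite scaler0 scalerA extaM mulVf // mulr1 -[LHS]/(1 *: v) scale1r.
exists (val c0), (val c1), (val c2); split; first by split; apply: valP.
split; first by rewrite -!rmorphXn -!rmorphD norm0 rmorph0.
case=> z0 z1 z2; case/eqP: ci0; apply/val_inj.
case: i => [[|[|[|//]]] hi]; [apply: etrans z0|apply: etrans z1|apply: etrans z2];
  by congr (val (c _)); apply: val_inj.
Qed.

Lemma quaternion_module_dim : dim_le quaternion_module 2.
Proof.
move=> n u lt2n.
have [e e0 rel] :=
  tall_mx_row_relation (\matrix_(i < n, k < 2) (u i : 'cV_2) k 0) lt2n.
exists (fun i => e 0 i); split=> //.
under eq_bigr => i _ do rewrite quaternion_module_scalar.
apply/colP => k; rewrite summxE mxE.
have := congr1 (fun M : 'rV[conic_field]_2 => M 0 k) rel; rewrite !mxE => h.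
by apply: etrans h; apply: eq_bigr => i _; rewrite !mxE.
Qed.

Definition quat_basis (i : 'I_4) : quaternion :=
  nth 0 [:: 1; quat_x; quat_y; quat_x * quat_y] i.

Lemma quat_basis_span (q : quaternion) :
  exists c : 'I_4 -> rat, q = \sum_i c i *: quat_basis i.
Proof.
have [c0 [c1 [c2 [c3 ->]]]] := quaternion_span q.
exists (fun i => nth 0 [:: c0; c1; c2; c3] i).
exact: quat_comb_sum.
Qed.

Lemma quaternion_module_isotropic (L : intermediate_field conic_rat) :
    field_of_definition quaternion_module L ->
  exists c0 c1 c2, [/\ c0 \in L, c1 \in L & c2 \in L] /\
    [/\ c0 ^+ 2 + c1 ^+ 2 + c2 ^+ 2 = 0 & ~ [/\ c0 = 0, c1 = 0 & c2 = 0]].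
Proof.
apply: (field_of_definition_isotropic quat_xx quat_yy quat_yx quat_basis_span).
  exact: quaternion_module_dim.
exists (const_mx 1); apply/eqP => /(congr1 (fun M : 'cV[conic_field]_2 => M 0 0)).
by rewrite !mxE => /eqP; rewrite oner_eq0.
Qed.

(** A bounded field is contained in Q, where a sum of squares vanishes only
    trivially. *)
Lemma bounded_not_field_of_definition (L : intermediate_field conic_rat) :
  (forall t, t \in L -> conic_abs conic_fieldP t <= 1) ->
  ~ field_of_definition quaternion_module L.
Proof.
move=> bndL /quaternion_module_isotropic[c0 [c1 [c2 [[L0 L1 L2] [norm0 nz]]]]].
have [r0 e0] := subfield_bounded_rat bndL L0.
have [r1 e1] := subfield_bounded_rat bndL L1.
have [r2 e2] := subfield_bounded_rat bndL L2.
have r_norm0 : r0 ^+ 2 + r1 ^+ 2 + r2 ^+ 2 = 0.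
  by apply: (fmorph_inj conic_rat); rewrite !rmorphD !rmorphXn rmorph0 /= -e0 -e1 -e2.
have [s0 s1 s2] := And3 (sqr_ge0 r0) (sqr_ge0 r1) (sqr_ge0 r2).
have z0 : r0 ^+ 2 = 0 by lra.
have z1 : r1 ^+ 2 = 0 by lra.
have z2 : r2 ^+ 2 = 0 by lra.
move/eqP: z0; move/eqP: z1; move/eqP: z2; rewrite !sqrf_eq0 => /eqP z2 /eqP z1 /eqP z0.
by case: nz; rewrite e0 e1 e2 z0 z1 z2 rmorph0.
Qed.

(** * Descent of a matrix representation with entries in a subfield *)

Lemma linear_bijection_isomorphic (R : pzRingType) (V W : lmodType R)
    (g : W -> V) (h : V -> W) :
    (forall y z, g (y + z) = g y + g z) -> (forall c y, g (c *: y) = c *: g y) ->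
    cancel g h -> cancel h g ->
  lmod_isomorphic V W.
Proof.
move=> gD gZ gK hK.
have h_lin : linear h.
  by move=> c u v; apply: (can_inj gK); rewrite gD gZ !hK.
pose hL : {linear V -> W} := HB.pack h (GRing.isLinear.Build _ _ _ _ h h_lin).
by exists hL; exists g.
Qed.

Lemma finitely_generated_ord (R : pzRingType) (V : lmodType R) n (w : 'I_n -> V) :
  (forall v, exists c : 'I_n -> R, v = \sum_i c i *: w i) -> finitely_generated V.
Proof.
move=> span_w; exists (mktuple w) => v; have [c ->] := span_w v.
have sz := size_tuple (mktuple w); exists (fun i => c (cast_ord sz i)).
rewrite (reindex (cast_ord sz)) /=; last first.
  by exists (cast_ord (esym sz)) => i _; rewrite ?cast_ordK ?cast_ordKV.
apply: eq_bigr => i _; congr (_ *: _).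
have -> : (mktuple w)`_i = tnth (mktuple w) (cast_ord sz i) by rewrite (tnth_nth 0).
by rewrite tnth_mktuple.
Qed.

(** An alias, so that the module structure over the coefficients does not
    compete with the one over the extended algebra. *)
Definition columns (K : fieldType) d : Type := 'cV[K]_d.
HB.instance Definition _ K d := GRing.Zmodule.on (columns K d).

(** Here [M] is the space of column vectors over E on which [A] acts through
    [rho], transported along [f]; that [rho] is a representation follows from
    the module axioms of [M]. *)
Section MatrixDescent.
Variables (F E : fieldType) (iota : {rmorphism F -> E}) (A : algType F).
Variables (M : lmodType (ext_algebra iota A)) (L : intermediate_field iota).
Variables (d : nat) (rho : A -> 'M[E]_d) (f : 'cV[E]_d -> M) (f' : M -> 'cV[E]_d).
Hypotheses (fK : cancel f f') (f'K : cancel f' f).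
Hypothesis fD : forall u v, f (u + v) = f u + f v.
Hypothesis frho : forall e a v, exta iota e a *: f v = f (e *: (rho a *m v)).
Hypothesis rhoL : forall a i j, rho a i j \in L.
Local Notation K := (subfield_of L).
Local Notation jL := (@base_incl F E iota L).
Local Notation incl := (@subfield_incl F E iota L).

Let mx_ext m n (B C : 'M[E]_(m, n)) : (forall v : 'cV_n, B *m v = C *m v) -> B = C.
Proof.
move=> BC; apply/matrixP => i k.
by have := congr1 (fun N : 'cV[E]_m => N i 0) (BC (delta_mx k 0)); rewrite -!colE !mxE.
Qed.

Definition descended_rep (a : A) : 'M[K]_d := \matrix_(i, k) SubfieldOf (rhoL a i k).

Lemma map_descended_rep a : map_mx incl (descended_rep a) = rho a.
Proof. by apply/matrixP => i k; rewrite !mxE. Qed.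

Lemma rhoD a b : rho (a + b) = rho a + rho b.
Proof.
apply: mx_ext => v; apply: (can_inj fK); rewrite mulmxDl fD -[_ *m v]scale1r -frho.
by rewrite extaDr scalerDl !frho !scale1r.
Qed.

Lemma rhoM a b : rho (a * b) = rho a *m rho b.
Proof.
apply: mx_ext => v; apply: (can_inj fK).
rewrite -[_ *m v in LHS]scale1r -[_ *m v in RHS]scale1r -frho -mulmxA -frho.
by rewrite -[rho b *m v]scale1r -frho scalerA extaM mulr1.
Qed.

Lemma rho1 : rho 1 = 1%:M.
Proof.
apply: mx_ext => v; apply: (can_inj fK); rewrite mul1mx -[_ *m v]scale1r -frho.
by rewrite -[exta _ _ _]/(1 : ext_algebra iota A) scale1r.
Qed.

Lemma rhoZ c a : rho (c *: a) = iota c *: rho a.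
Proof.
apply: mx_ext => v; apply: (can_inj fK); rewrite -[_ *m v in LHS]scale1r -frho.
by rewrite -exta_bal mul1r frho scalemxAl.
Qed.

Definition descended_action (t : ext_algebra jL A) : 'M[K]_d :=
  tensor_lift (fun k a => k *: descended_rep a) t.

Let incl_inj m n : injective (@map_mx _ _ incl m n).
Proof. by move=> B C /map_mx_inj; apply. Qed.

Lemma descended_bal : balanced jL (fun k (a : A) => k *: descended_rep a).
Proof.
split=> [k k' a|k a a'|k c a].
- exact: scalerDl.
- rewrite -scalerDr; congr (_ *: _); apply: incl_inj.
  by rewrite map_mxD !map_descended_rep rhoD.
- rewrite -scalerA; congr (_ *: _); apply: incl_inj.
  by rewrite map_mxZ !map_descended_rep rhoZ.
Qed.

Lemma descended_action_exta k a : descended_action (exta jL k a) = k *: descended_rep a.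
Proof. exact/tensor_lift_tens/descended_bal. Qed.
Lemma descended_actionD t u : descended_action (t + u) = descended_action t + descended_action u.
Proof. exact/tensor_liftD/descended_bal. Qed.
Lemma descended_action0 : descended_action 0 = 0.
Proof. exact/tensor_lift0/descended_bal. Qed.

Lemma descended_rep1 : descended_rep 1 = 1%:M.
Proof. by apply: incl_inj; rewrite map_descended_rep rho1 map_mx1. Qed.

Lemma descended_actionM t u :
  descended_action (t * u) = descended_action t *m descended_action u.
Proof.
elim/ext_algebra_ind: t => [k a||t t' IHt IHt'].
- elim/ext_algebra_ind: u => [l b||u u' IHu IHu'].
  + rewrite extaM !descended_action_exta -scalemxAl -scalemxAr scalerA.
    by congr (_ *: _); apply: incl_inj; rewrite map_mxM !map_descended_rep rhoM.
  + by rewrite mulr0 descended_action0 mulmx0.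
  + by rewrite mulrDr !descended_actionD IHu IHu' mulmxDr.
- by rewrite mul0r descended_action0 mul0mx.
by rewrite mulrDl !descended_actionD IHt IHt' mulmxDl.
Qed.

Definition descended_scale (t : ext_algebra jL A) (v : columns K d) : columns K d :=
  descended_action t *m v.

Fact descended_scaleA t u v :
  descended_scale t (descended_scale u v) = descended_scale (t * u) v.
Proof. by rewrite /descended_scale descended_actionM mulmxA. Qed.
Fact descended_scale1 : left_id 1 descended_scale.
Proof.
move=> v; rewrite /descended_scale [descended_action 1]descended_action_exta.
by rewrite scale1r descended_rep1 mul1mx.
Qed.
Fact descended_scaleDr : right_distributive descended_scale +%R.
Proof. by move=> t u v; apply: mulmxDr. Qed.
Fact descended_scaleDl v : {morph descended_scale^~ v : t u / t + u}.
Proof. by move=> t u; rewrite /descended_scale descended_actionD mulmxDl. Qed.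

Definition descended_module : lmodType (ext_algebra jL A) :=
  HB.pack_for (lmodType (ext_algebra jL A)) (columns K d)
    (GRing.Zmodule_isLmodule.Build (ext_algebra jL A) (columns K d)
      descended_scaleA descended_scale1 descended_scaleDr descended_scaleDl).
Local Notation M0 := descended_module.

Lemma descended_scaleE k a (v : M0) :
  exta jL k a *: v = k *: (descended_rep a *m (v : 'cV[K]_d)) :> 'cV[K]_d.
Proof.
rewrite -[LHS]/(descended_action (exta jL k a) *m (v : 'cV[K]_d)).
by rewrite descended_action_exta -scalemxAl.
Qed.

Definition descent_map (z : base_change M0) : M :=
  tensor_lift (M := restrict_scalars (ext_scalar jL A) M0) (phi := incl)
    (fun e (v : M0) => f (e *: map_mx incl (v : 'cV[K]_d))) z.

Lemma descent_map_bal : balanced (M := restrict_scalars (ext_scalar jL A) M0) incl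
  (fun e (v : M0) => f (e *: map_mx incl (v : 'cV[K]_d))).
Proof.
split=> [e e' v|e u v|e k v].
- by rewrite scalerDl fD.
- by rewrite map_mxD scalerDr fD.
by rewrite restrict_scaleE descended_scaleE descended_rep1 mul1mx map_mxZ scalerA.
Qed.

Lemma descent_map_tens e v :
  descent_map (base_tens e v) = f (e *: map_mx incl (v : 'cV[K]_d)).
Proof. exact/tensor_lift_tens/descent_map_bal. Qed.
Lemma descent_mapD y z : descent_map (y + z) = descent_map y + descent_map z.
Proof. exact/tensor_liftD/descent_map_bal. Qed.
Lemma descent_map0 : descent_map 0 = 0.
Proof. exact/tensor_lift0/descent_map_bal. Qed.

Lemma base_change_ind (P : base_change M0 -> Prop) :
  (forall e v, P (base_tens e v)) -> P 0 -> (forall y z, P y -> P z -> P (y + z)) ->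
  forall z, P z.
Proof. exact: (@tensor_ind _ _ incl (restrict_scalars (ext_scalar jL A) M0) P). Qed.

Lemma descent_mapZ t z : descent_map (t *: z) = t *: descent_map z.
Proof.
elim/base_change_ind: z => [e v||y z IHy IHz]; last 2 first.
- by rewrite scaler0 descent_map0 scaler0.
- by rewrite scalerDr !descent_mapD IHy IHz scalerDr.
elim/ext_algebra_ind: t => [e' a||t u IHt IHu]; last 2 first.
- by rewrite !scale0r descent_map0.
- by rewrite !scalerDl descent_mapD IHt IHu.
rewrite -[_ *: _ in LHS]/(base_scale (exta iota e' a) (base_tens e v)).
rewrite base_scale_tens base_act_tens !descent_map_tens frho descended_scaleE.
by rewrite scale1r map_mxM map_descended_rep -scalemxAr scalerA.
Qed.

Definition descent_inv (m : M) : base_change M0 :=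
  \sum_i base_tens (M0 := M0) (f' m i 0) (delta_mx i 0 : 'cV[K]_d).

Lemma descent_invD m n : descent_inv (m + n) = descent_inv m + descent_inv n.
Proof.
rewrite /descent_inv -big_split; apply: eq_bigr => i _ /=.
have -> : f' (m + n) = f' m + f' n by apply: (can_inj fK); rewrite fD !f'K.
by rewrite mxE /base_tens tensDl.
Qed.

Let col_delta (R : nzRingType) (v : 'cV[R]_d) : v = \sum_i v i 0 *: delta_mx i 0.
Proof.
apply/colP => k; rewrite summxE (bigD1 k) //= big1 ?addr0 => [|i ik].
  by rewrite !mxE !eqxx mulr1.
by rewrite !mxE eq_sym (negPf ik) mulr0.
Qed.

Lemma descended_sum (v : M0) :
  v = \sum_i exta jL ((v : 'cV[K]_d) i 0) 1 *: ((delta_mx i 0 : 'cV[K]_d) : M0).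
Proof.
rewrite {1}(col_delta (v : 'cV[K]_d)); apply: eq_bigr => i _.
by rewrite descended_scaleE descended_rep1 mul1mx.
Qed.

Lemma descent_mapK : cancel descent_map descent_inv.
Proof.
elim/base_change_ind => [e v||y z IHy IHz].
- rewrite descent_map_tens /descent_inv fK [in RHS](descended_sum v).
  rewrite -[RHS]/(tens (M := restrict_scalars (ext_scalar jL A) M0) incl e _).
  rewrite (tens_sumr incl); apply: eq_bigr => i _.
  by rewrite -restrict_scaleE -tens_bal !mxE.
- apply: (addrI (descent_inv (descent_map 0))).
  by rewrite -descent_invD -descent_mapD !addr0.
by rewrite descent_mapD descent_invD IHy IHz.
Qed.

Lemma descent_invK : cancel descent_inv descent_map.
Proof.
move=> m; rewrite /descent_inv (big_morph _ descent_mapD descent_map0).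
have f0 : f 0 = 0 by apply: (addrI (f 0)); rewrite -fD !addr0.
rewrite -[RHS]f'K [in RHS](col_delta (f' m)) (big_morph f fD f0).
by apply: eq_bigr => i _; rewrite descent_map_tens map_delta_mx.
Qed.

Lemma matrix_descent : field_of_definition M L.
Proof.
exists M0; split; last first.
  exact: linear_bijection_isomorphic descent_mapD descent_mapZ descent_mapK descent_invK.
apply: (finitely_generated_ord (V := M0) (w := fun i => delta_mx i 0 : 'cV[K]_d)) => v.
by exists (fun i => exta jL ((v : 'cV[K]_d) i 0) 1); apply: descended_sum.
Qed.
End MatrixDescent.

(** * Descent to a field that contains a point of the conic *)

Section Intertwiner.
Variables (E : fieldType) (a b al be : E).
Hypotheses (ab : a ^+ 2 + b ^+ 2 = -1) (al_be : al ^+ 2 + be ^+ 2 = -1).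

Definition intertwines (P : 'M[E]_2) : Prop :=
  mx22 a b b (- a) *m P = P *m mx22 al be be (- al) /\
  mx22 b (- a) (- a) (- b) *m P = P *m mx22 be (- al) (- al) (- be).

(** In both representations [x * y] acts by the rotation [mx22 0 1 (-1) 0], so
    an intertwiner commutes with it and has the shape [mx22 p q (- q) p]. *)
Lemma rotation_intertwines p q :
  a * p - b * q = p * al + q * be -> b * p + a * q = p * be - q * al ->
  intertwines (mx22 p q (- q) p).
Proof.
move=> h1 h2; split; rewrite -![_ *m _]/(_ * _) !mx22M; congr mx22.
- by transitivity (a * p - b * q); [ring | rewrite h1; ring].
- by transitivity (b * p + a * q); [ring | rewrite h2; ring].
- by transitivity (b * p + a * q); [ring | rewrite h2; ring].
- by transitivity (- (a * p - b * q)); [ring | rewrite h1; ring].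
- by transitivity (b * p + a * q); [ring | rewrite h2; ring].
- by transitivity (- (a * p - b * q)); [ring | rewrite h1; ring].
- by transitivity (- (a * p - b * q)); [ring | rewrite h1; ring].
- by transitivity (- (b * p + a * q)); [ring | rewrite h2; ring].
Qed.

Lemma rotation_unit (p q : E) : p ^+ 2 + q ^+ 2 != 0 -> mx22 p q (- q) p \in unitmx.
Proof.
set n := _ + _ => n0.
have : mx22 p q (- q) p *m mx22 (p / n) (- (q / n)) (q / n) (p / n) = 1%:M.
  rewrite -[_ *m _]/(_ * _) mx22M -[RHS]mx22_1; congr mx22; rewrite /n;
  by field; rewrite n0.
by case/mulmx1_unit.
Qed.

(** Two candidates for [(p, q)], whose determinants add up to -4. *)
Lemma exists_intertwiner : (2 : E) != 0 -> exists2 P, P \in unitmx & intertwines P.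
Proof.
move=> two0.
have [n0|n0] := eqVneq ((a + al) ^+ 2 + (be - b) ^+ 2) 0; last first.
  exists (mx22 (a + al) (be - b) (- (be - b)) (a + al)); first exact: rotation_unit.
  apply: rotation_intertwines; last by ring.
  transitivity (a ^+ 2 + b ^+ 2 + (a * al - b * be)); first by ring.
  by rewrite ab -al_be; ring.
exists (mx22 (- (b + be)) (al - a) (- (al - a)) (- (b + be))).
  apply: rotation_unit.
  have -> : (- (b + be)) ^+ 2 + (al - a) ^+ 2 =
      2 * (a ^+ 2 + b ^+ 2 + (al ^+ 2 + be ^+ 2)) - ((a + al) ^+ 2 + (be - b) ^+ 2).
    by ring.
  rewrite n0 ab al_be subr0 -opprD mulrN oppr_eq0.
  by rewrite mulf_neq0.
apply: rotation_intertwines; first by ring.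
transitivity (- (a ^+ 2 + b ^+ 2) + (a * al - b * be)); first by ring.
by rewrite ab -al_be; ring.
Qed.

End Intertwiner.

Lemma mx_quat_comb c0 c1 c2 c3 :
  mx_quat (quat_comb quat_x quat_y c0 c1 c2 c3) =
  mx_rat c0 + mx_rat c1 * mx_x + mx_rat c2 * mx_y + mx_rat c3 * (mx_x * mx_y).
Proof.
have ex : mx_quat quat_x = mx_x by rewrite [LHS]mx_quat_cl mx_eval_x.
have ey : mx_quat quat_y = mx_y by rewrite [LHS]mx_quat_cl mx_eval_y.
rewrite -ex -ey -[mx_rat c0]mulr1 -mx_quat1 -mx_quatM -!mx_quatZ.
by rewrite -!mx_quatD.
Qed.

Section Conjugate.
Variables (E : fieldType) (P X X' Y Y' : 'M[E]_2).
Hypotheses (Pu : P \in unitmx) (XP : X *m P = P *m X') (YP : Y *m P = P *m Y').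

Lemma conjugate_comb (c0 c1 c2 c3 : E) :
  invmx P *m (c0%:M + c1%:M * X + c2%:M * Y + c3%:M * (X * Y)) *m P =
  c0%:M + c1 *: X' + c2 *: Y' + c3 *: (X' *m Y').
Proof.
suff e : (c0%:M + c1%:M * X + c2%:M * Y + c3%:M * (X * Y)) *m P =
    P *m (c0%:M + c1 *: X' + c2 *: Y' + c3 *: (X' *m Y')).
  by rewrite -mulmxA e mulKmx.
have scal c (Z Z' : 'M[E]_2) : Z *m P = P *m Z' -> (c%:M * Z) *m P = P *m (c *: Z').
  move=> ZP; have -> : c%:M * Z = c *: Z by apply: mul_scalar_mx.
  by rewrite -scalemxAl -scalemxAr ZP.
rewrite !mulmxDl !mulmxDr scalar_mxC (scal c1 _ _ XP) (scal c2 _ _ YP).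
by rewrite (scal c3 _ (X' *m Y')) // -mulmxA YP mulmxA XP -mulmxA.
Qed.
End Conjugate.

Lemma mx22_closed (E : fieldType) (S : {pred E}) p q r s :
    p \in S -> q \in S -> r \in S -> s \in S ->
  forall i k, mx22 p q r s i k \in S.
Proof.
by move=> Sp Sq Sr Ss i k; rewrite mxE; case: i k => [[|[|//]] ?] [[|[|//]] ?].
Qed.

Lemma comb_closed (E : fieldType) (S : divringClosed E) (X Y : 'M[E]_2) c0 c1 c2 c3 :
    [/\ c0 \in S, c1 \in S, c2 \in S & c3 \in S] ->
    (forall i k, X i k \in S) -> (forall i k, Y i k \in S) ->
  forall i k, (c0%:M + c1 *: X + c2 *: Y + c3 *: (X *m Y)) i k \in S.
Proof.
move=> [S0 S1 S2 S3] SX SY i k; rewrite !mxE.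
rewrite !rpredD ?rpredMn ?rpredM ?SX ?SY //.
by apply: rpred_sum => l _; rewrite rpredM ?SX ?SY.
Qed.

(** Conjugating by an intertwiner turns [(a, b)] into [(al, be)], so that the
    matrices acquire entries in L. *)
Lemma point_field_of_definition (L : intermediate_field conic_rat) al be :
    al \in L -> be \in L -> al ^+ 2 + be ^+ 2 = -1 ->
  field_of_definition quaternion_module L.
Proof.
move=> Lal Lbe al_be.
have two0 : (2 : conic_field) != 0.
  by rewrite -(rmorph_nat conic_rat) fmorph_eq0.
have [P Pu [XP YP]] := exists_intertwiner conic_eq al_be two0.
have rhoL q i k : (invmx P *m mx_quat q *m P) i k \in L.
  have [c0 [c1 [c2 [c3 ->]]]] := quaternion_span q.
  rewrite mx_quat_comb (conjugate_comb Pu XP YP).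
  apply: comb_closed; first by split; apply: intermediate_base.
    by apply: mx22_closed; rewrite ?rpredN.
  by apply: mx22_closed; rewrite ?rpredN.
apply: (matrix_descent (rho := fun q => invmx P *m mx_quat q *m P)
  (f := fun v => P *m v : quaternion_module) (f' := fun v => invmx P *m v)) => //.
- by move=> v; rewrite mulKmx.
- by move=> v; rewrite mulKVmx.
- by move=> u v; rewrite mulmxDr.
move=> e q v; rewrite -[LHS]/(mx_rep (exta conic_rat e q) *m (P *m v)).
by rewrite mx_rep_tens -scalemxAl -scalemxAr !mulmxA mulmxV // mul1mx.
Qed.

(** * Transcendence degree *)

Section AlgIndependent.
Variables (E : fieldType) (iota : {rmorphism rat -> E}).

Lemma alg_independent1 (t : E) :
    (forall p, pev iota t p = 0 -> p = 0) ->
  alg_independent iota (fun _ : 'I_1 => t).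
Proof.
move=> indep P P0; pose q := mpoly.mmap polyC (fun _ : 'I_1 => 'X) P : {poly rat}.
have q0 : q = 0.
  apply: indep; rewrite /q /mpoly.mmap rmorph_sum -[RHS]P0 /=.
  apply: eq_bigr => m _; rewrite rmorphM /= pevC; congr (_ * _).
  rewrite /mpoly.mmap1 rmorph_prod /=.
  by apply: eq_bigr => i _; rewrite rmorphXn /= pevX.
apply/mpoly.mpolyP => m; rewrite mpoly.mcoeff0.
have := congr1 (fun p : {poly rat} => p`_(m ord0)) q0.
rewrite /q /mpoly.mmap coef_sum coef0.
have term k : ((mpoly.mcoeff k P)%:P * mpoly.mmap1 (fun _ : 'I_1 => 'X : {poly rat}) k)`_(m ord0) =
    mpoly.mcoeff k P * (k == m)%:R.
  rewrite coefCM /mpoly.mmap1 big_ord1 coefXn; congr (_ * _%:R).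
  congr nat_of_bool; apply/eqP/eqP => [e|-> //]; apply/mpoly.mnmP => i.
  by rewrite (ord1 i).
under eq_bigr => k _ do rewrite term.
have [mP|mP] := boolP (m \in mpoly.msupp P).
  rewrite (bigD1_seq m) //= ?mpoly.msupp_uniq // eqxx mulr1 big1 ?addr0 //.
  by move=> k /negPf ->; rewrite mulr0.
by move=> _; apply/eqP; rewrite -[_ == _]negbK -mpoly.mcoeff_msupp.
Qed.

Lemma alg_dependent2 m (t : 'I_m -> E) (i0 i1 : 'I_m) K (c : 'I_K * 'I_K -> rat) :
    i0 != i1 -> (exists ij, c ij != 0) ->
    \sum_ij iota (c ij) * (t i0 ^+ ij.1 * t i1 ^+ ij.2) = 0 ->
  ~ alg_independent iota t.
Proof.
move=> i01 [ij0 cij0] rel indep.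
pose mn (ij : 'I_K * 'I_K) : mpoly.multinom m := mpoly.Multinom
  [tuple (if i == i0 then nat_of_ord ij.1 else if i == i1 then nat_of_ord ij.2 else 0%N) | i < m].
have mnE ij i : mn ij i =
    (if i == i0 then nat_of_ord ij.1 else if i == i1 then nat_of_ord ij.2 else 0%N).
  by rewrite /mpoly.fun_of_multinom tnth_mktuple.
have mn_inj : injective mn.
  move=> [j k] [j' k'] e; have := congr1 (fun M : mpoly.multinom m => M i0) e.
  have := congr1 (fun M : mpoly.multinom m => M i1) e.
  rewrite !mnE eqxx eq_sym (negPf i01) /= eqxx => e2 e1.
  by congr pair; apply: val_inj.
pose P := \sum_ij c ij *: mpoly.mpolyX rat (mn ij).
have : P = 0.
  apply: indep; rewrite -[RHS]rel /P (big_morph _ (mpoly.mmapD t iota) (mpoly.mmap0 t iota)).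
  apply: eq_bigr => ij _; rewrite mpoly.mmapZ mpoly.mmapX; congr (_ * _).
  rewrite /mpoly.mmap1 (bigD1 i0) //= (bigD1 i1) 1?eq_sym //= big1 ?mulr1.
    by rewrite !mnE !eqxx eq_sym (negPf i01).
  by move=> i /andP[/negPf ii0 /negPf ii1]; rewrite mnE ii0 ii1.
move/(congr1 (mpoly.mcoeff (mn ij0))); rewrite /P mpoly.mcoeff0.
rewrite (big_morph _ (mpoly.mcoeffD _) (mpoly.mcoeff0 _ _)) (bigD1 ij0) //= big1.
  by rewrite addr0 mpoly.mcoeffZ mpoly.mcoeffX eqxx mulr1 => /eqP; rewrite (negPf cij0).
by move=> ij /negPf ne; rewrite mpoly.mcoeffZ mpoly.mcoeffX (inj_eq mn_inj) ne mulr0.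
Qed.
End AlgIndependent.

Section FullSubfield.
Variables (E : fieldType) (iota : {rmorphism rat -> E}).

Fact full_field_closed : divring_closed (fun _ : E => true).
Proof. by []. Qed.

Definition full_subfield : intermediate_field iota :=
  @IntermediateField _ _ iota
    (HB.pack_for (GRing.DivringClosed.type E) (fun _ : E => true)
      (GRing.isDivringClosed.Build E (fun _ : E => true) full_field_closed))
    (fun _ => isT).
End FullSubfield.

Lemma conic_full_trdeg : trdeg_eq (full_subfield conic_rat) 1.
Proof.
split.
  exists (fun=> conic_a); split=> //; apply: alg_independent1 => p pa0.
  apply/eqP; have := pev_a_eq0 conic_fieldP p.
  by rewrite pa0 eqxx => <-.
move=> m t _ indep; rewrite leqNgt; apply/negP => lt1m.
pose i0 := Ordinal (ltnW lt1m); pose i1 := Ordinal lt1m.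
have [K [c [nzc rel]]] := conic_alg_dependent conic_fieldP (t i0) (t i1).
exact: (alg_dependent2 (i0 := i0) (i1 := i1) _ nzc rel).
Qed.

Lemma trdeg0_bounded (L : intermediate_field conic_rat) :
  trdeg_eq L 0 -> forall t, t \in L -> conic_abs conic_fieldP t <= 1.
Proof.
move=> [_ max0] t Lt; have : ~ forall p, pev conic_rat t p = 0 -> p = 0.
  by move=> /alg_independent1 indep; have := max0 _ _ (fun=> Lt) indep.
move=> /existsNP[p /not_implyP[p0 /eqP nzp]].
exact: (conic_abs_algebraic conic_fieldP nzp p0).
Qed.

(** * The proposition *)

Theorem proposition6p3 :
  ed_eq quaternion_module 1 /\
  ~ exists L : intermediate_field conic_rat,
      minimal_field_of_definition quaternion_module L.
Proof.
split; [split|].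
- exists (full_subfield conic_rat); last exact: conic_full_trdeg.
  exact: (point_field_of_definition (al := conic_a) (be := conic_b) _ _ conic_eq).
- move=> L [|n] // defL trL.
  by case: (bounded_not_field_of_definition (trdeg0_bounded trL)).
case=> L [defL minL]; apply: bounded_not_field_of_definition defL => t Lt.
apply: all_point_fields_bounded => al be al_be.
apply: (minL (point_subfield conic_rat al_be)) Lt.
apply: (point_field_of_definition _ _ al_be).
  exact: point_subfield_al.
exact: point_subfield_be.
Qed.
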